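(* If an unsigned bipartite graph $G$ contains a cycle whose edges are, in cyclic order, $\epsilon_1,\delta_1,\epsilon_2,\delta_2,\ldots,\epsilon_n,\delta_n$, then $$I'_G(x)=\sum_{\emptyset\neq\mathcal{S}\subset\{\epsilon_1,\epsilon_2,\ldots,\epsilon_n\}}(-1)^{|\mathcal{S}|-1}I'_{G\setminus\mathcal{S}}(x),$$ where the sum is over all non-empty subsets $\mathcal{S}$ of $\{\epsilon_1,\ldots,\epsilon_n\}$ (including the whole set).
   Context: Graphs are finite; parallel edges are allowed; graphs need not be planar or connected. A bipartite graph $G=(V,E,\mathcal{E})$ has color classes $V$ and $E$ (both consisting of vertices) and edge set $\mathcal{E}$. For $\mathcal{S}\subseteq\mathcal{E}$, $G\setminus\mathcal{S}$ is obtained by deleting the edges in $\mathcal{S}$, keeping all vertices. **Interior polynomial.** If $G$ is connected, a hypertree is a function $f:E\to\mathbb{Z}_{\ge 0}$ such that $G$ has a spanning tree with degree $f(e)+1$ at every $e\in E$. Fix a total order on $E$. Given a hypertree $f$, an element $e\in E$ is internally inactive if there is some $e'<e$ such that decreasing $f(e)$ by $1$ and increasing $f(e')$ by $1$ yields a hypertree. The interior polynomial is $I_G(x)=\sum_f x^{\bar\iota(f)}$, where $f$ runs over all hypertrees and $\bar\iota(f)$ is the number of internally inactive elements of $E$; for a single-vertex graph $I_G(x)=1$. (It is known that $I_G$ does not depend on the order and is unchanged when the roles of $V$ and $E$ are exchanged.) For a possibly disconnected $G$ with connected components $G_1,\dots,G_{k}$, $k=k(G)$, set $I'_G(x)=(1-x)^{k-1}\prod_{i=1}^{k}I_{G_i}(x)$.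 *)

(* Defs.v *)
From mathcomp Require Import all_boot all_order all_algebra.
Set Implicit Arguments.
Unset Strict Implicit.
Unset Printing Implicit Defensive.
Import GRing.Theory.
Local Open Scope ring_scope.

(* A finite bipartite multigraph: the edge x joins endV x to endE x, and
   distinct edges may have the same ends. *)
Record bigraph := BiGraph {
  classV : finType;
  classE : finType;
  edge : finType;
  endV : edge -> classV;
  endE : edge -> classE
}.

Definition vertex (G : bigraph) : finType := (classV G + classE G)%type.

(* Subgraphs of G are given by a vertex set W and an edge set A.  The graph
   obtained from G by deleting the edges in S has all the vertices of G and
   the edge set ~: S. *)

Definition joins (G : bigraph) (x : edge G) (u v : vertex G) : bool :=
  ((u == inl (endV x)) && (v == inr (endE x)))
  || ((u == inr (endE x)) && (v == inl (endV x))).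

Definition adjacent (G : bigraph) (A : {set edge G}) : rel (vertex G) :=
  fun u v => [exists x in A, joins x u v].

(* c lists, in cyclic order, the edges of a cycle without repeated vertices:
   the i-th edge joins the i-th and the (i+1)-st vertices of p, cyclically.
   The condition uniq c only matters for length 2, where it requires two
   distinct parallel edges. *)
Definition is_cycle (G : bigraph) (c : seq (edge G)) : bool :=
  [&& c != [::], uniq c &
    [exists p : (size c).-tuple (vertex G), uniq p &&
      [forall i : 'I_(size c),
        joins (tnth (in_tuple c) i) (tnth p i) (tnth p (ordS i))]]].

(* Cycles have no repeated edge, so lengths up to #|edge G| suffice. *)
Definition acyclic (G : bigraph) (T : {set edge G}) : bool :=
  [forall m : 'I_#|edge G|.+1, forall c : m.-tuple (edge G),
    all (mem T) c ==> ~~ is_cycle c].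

Definition spanning_tree (G : bigraph) (W : {set vertex G})
    (A T : {set edge G}) : bool :=
  [&& T \subset A, acyclic T &
    [forall u in W, forall v in W, connect (adjacent T) u v]].

Definition degE (G : bigraph) (T : {set edge G}) (e : classE G) : nat :=
  #|[set x in T | endE x == e]|.

(* A hypertree of the connected graph with vertex set W and edge set A is a
   function on the elements of classE G lying in W; it is represented by its
   extension by 0 to classE G. *)
Definition hypertree (G : bigraph) (W : {set vertex G}) (A : {set edge G})
    (f : classE G -> nat) : bool :=
  [forall e, (inr e \notin W) ==> (f e == 0%N)]
  && [exists T : {set edge G}, spanning_tree W A T &&
       [forall e, (inr e \in W) ==> (degE T e == (f e).+1)]].

(* Only used when 0 < f e and e != e', so that .-1 is a true subtraction. *)
Definition transfer (G : bigraph) (f : classE G -> nat) (e e' : classE G) :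
    classE G -> nat :=
  fun a => if a == e then (f a).-1 else if a == e' then (f a).+1 else f a.

Definition internally_inactive (G : bigraph) (leE : rel (classE G))
    (W : {set vertex G}) (A : {set edge G}) (f : classE G -> nat)
    (e : classE G) : bool :=
  (inr e \in W) &&
  [exists e', [&& inr e' \in W, leE e' e, e' != e, (0 < f e)%N
                & hypertree W A (transfer f e e')]].

(* Values of hypertrees are smaller than the number of edges, so the sum
   ranges over all of them.  The case #|W| = 1 is separate because a single
   vertex in classE G has degree 0 and hence admits no hypertree. *)
Definition interior_poly (G : bigraph) (leE : rel (classE G))
    (W : {set vertex G}) (A : {set edge G}) : {poly int} :=
  if #|W| == 1%N then 1 else
  \sum_(f : {ffun classE G -> 'I_#|edge G|.+1} | hypertree W A (fun e => f e))
    'X^#|[set e | internally_inactive leE W A (fun e => f e) e]|.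

Definition components (G : bigraph) (A : {set edge G}) : {set {set vertex G}} :=
  equivalence_partition (connect (adjacent A)) [set: vertex G].

Definition edges_in (G : bigraph) (A : {set edge G}) (C : {set vertex G}) :
    {set edge G} :=
  [set x in A | (inl (endV x) \in C) && (inr (endE x) \in C)].

(* The polynomial I' of the graph with all the vertices of G and edge set A;
   each component uses the restriction of leE. *)
Definition interior_poly' (G : bigraph) (leE : rel (classE G))
    (A : {set edge G}) : {poly int} :=
  (1 - 'X) ^+ #|components A|.-1
  * \prod_(C in components A) interior_poly leE C (edges_in A C).

(* Main.v *)
Require Import Defs.
From mathcomp Require Import all_boot all_order all_algebra.
From mathcomp Require Import zify ring.
Set Implicit Arguments.
Unset Strict Implicit.
Unset Printing Implicit Defensive.
Import GRing.Theory.
Local Open Scope ring_scope.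

(** Let [D(A)] be the set of the functions [h] on E such that every nonempty
    set X of elements with [h > 0] satisfies [\sum_X (h - 1) < |N_A(X)|]; these
    are the E-degree vectors of the forests contained in A.  The point is
    the formula
      [I'_A = \sum_(h in D(A)) x^|supp h| (1 - x)^(|V| + |E| - 1 - |h|)],
    after which it suffices to show, for each [h], that the alternating sum over
    S of the truth values of [h \in D(~: S)] vanishes.

    For a 4-cycle this says that the truth value of [h \in D(R)] is modular in
    the deletion of the two epsilons, which follows from the submodularity of
    [X |-> |N(X)|]; a longer cycle is cut by a chord into a 4-cycle and a
    shorter cycle.

    The formula is multiplicative over connected components.  For a connected
    graph the hypertrees are the bases of the polymatroid
    [f(X) < |N(X)|], and each [h] in [D] lies in exactly one box
    [{h <= f + 1, with equality at the inactive elements}] with [f] a base; the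
    terms of the formula with [h] in the box of [f] add up to the monomial of
    [f] in the interior polynomial. *)

(** * Draconian vectors and the cycle relation *)

Section Draconian.
Variables V E : finType.
Implicit Types (R : {set V * E}) (X Y Q : {set E}) (f h : E -> nat).

Definition nbr R X : {set V} := [set p.1 | p in R & p.2 \in X].

(** A strict Hall condition, known as the dragon marriage condition. Strictness reflects that a
    forest on X and N(X) has fewer than |X| + |N(X)| edges. *)
Definition draconian R Q f : bool :=
  [forall X : {set E}, (X != set0) && (X \subset Q) ==>
    (\sum_(e in X) f e < #|nbr R X|)%N].

Lemma nbrP R X v : reflect (exists2 e, e \in X & (v, e) \in R) (v \in nbr R X).
Proof.
apply: (iffP imsetP) => [[[w e]]|[e eX veR]].
  by rewrite inE /= => /andP[weR eX] ->; exists e.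
by exists (v, e); rewrite ?inE ?veR.
Qed.

Lemma mem_nbr R X v e : e \in X -> (v, e) \in R -> v \in nbr R X.
Proof. by move=> eX veR; apply/nbrP; exists e. Qed.

Lemma nbrU R X Y : nbr R (X :|: Y) = nbr R X :|: nbr R Y.
Proof.
apply/setP => v; rewrite inE; apply/nbrP/orP => [[e]|].
  by rewrite inE => /orP[] eX veR; [left|right]; apply: mem_nbr veR.
by case=> /nbrP[e eX veR]; exists e; rewrite // inE eX ?orbT.
Qed.

Lemma nbrS R R' X Y : R \subset R' -> X \subset Y -> nbr R X \subset nbr R' Y.
Proof.
move=> /subsetP sR /subsetP sX; apply/subsetP => v /nbrP[e /sX eY /sR].
exact: mem_nbr.
Qed.

Lemma nbrD1 R v e X : e \notin X -> nbr (R :\ (v, e)) X = nbr R X.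
Proof.
move=> eX; apply/setP => w; apply/nbrP/nbrP => -[a aX].
  by rewrite inE => /andP[_ ?]; exists a.
move=> waR; exists a => //; rewrite !inE waR andbT.
by apply: contraNneq eX => -[_ <-].
Qed.

Lemma draconianP R Q f :
  reflect (forall X, X != set0 -> X \subset Q ->
             (\sum_(e in X) f e < #|nbr R X|)%N)
          (draconian R Q f).
Proof.
apply: (iffP forallP) => H X.
  by move=> X0 XQ; have /implyP := H X; apply; rewrite X0.
by apply/implyP => /andP[]; apply: H.
Qed.

Lemma draconianPn R Q f :
  ~~ draconian R Q f ->
  exists X, [/\ X != set0, X \subset Q & (#|nbr R X| <= \sum_(e in X) f e)%N].
Proof.
rewrite negb_forall => /existsP[X]; rewrite negb_imply -leqNgt => /andP[/andP[]].
by exists X.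
Qed.

Lemma draconianS R R' Q f : R \subset R' -> draconian R Q f -> draconian R' Q f.
Proof.
move=> sR /draconianP H; apply/draconianP => X X0 XQ.
by apply: leq_trans (H X X0 XQ) _; apply/subset_leq_card/nbrS.
Qed.

Lemma sum_setUI f X Y :
  (\sum_(e in X :|: Y) f e + \sum_(e in X :&: Y) f e
   = \sum_(e in X) f e + \sum_(e in Y) f e)%N.
Proof.
rewrite (big_setID Y) /= [in RHS](big_setID Y) /= setIUl setIid setDUl setDv setU0.
by rewrite (setUidPr _) ?subsetIr //; clear; lia.
Qed.

Variables (Q : {set E}) (f : E -> nat).
Let D R := draconian R Q f.

(** * Modularity on a 4-cycle *)

Section Square.
Variables (R : {set V * E}) (v1 v2 : V) (e1 e2 : E).
Hypotheses (v21 : (v2, e1) \in R) (v12 : (v1, e2) \in R).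
Hypotheses (ne_v : v1 != v2) (ne_e : e1 != e2).

(** A set that avoids [e1] or [e2] notices at most one of the two deletions. A set containing both
    keeps [v2] as a neighbour through [e1], so the deletion of [(v2, e2)] costs it nothing. *)
Lemma draconian_square_and :
  D (R :\ (v1, e1)) -> D (R :\ (v2, e2)) -> D (R :\ (v1, e1) :\ (v2, e2)).
Proof.
move=> /draconianP D1 /draconianP D2; apply/draconianP => X X0 XQ.
have [e2X|e2X] := boolP (e2 \in X); last by rewrite nbrD1 //; apply: D1.
have [e1X|e1X] := boolP (e1 \in X); last first.
  by rewrite setDDl setUC -setDDl nbrD1 //; apply: D2.
apply: leq_trans (D1 X X0 XQ) _; apply/subset_leq_card/subsetP => v.
case/nbrP=> e eX veR; have [[-> _]|ne] := eqVneq (v, e) (v2, e2).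
  apply: (mem_nbr e1X); rewrite !in_setD1 v21 !xpair_eqE (negPf ne_e) andbF.
  by rewrite eq_sym (negPf ne_v).
by apply: mem_nbr eX _; rewrite in_setD1 ne.
Qed.

(** Uncrossing: a set violated by the first deletion contains [e1] but not [e2], one violated by the
    second contains [e2] but not [e1]. Their union loses no neighbour, as [v1] is reached through
    [e2] and [v2] through [e1], and their intersection is untouched. Submodularity then contradicts
    the condition for [R]. *)
Lemma draconian_square_or : D R -> D (R :\ (v1, e1)) || D (R :\ (v2, e2)).
Proof.
move=> /draconianP DR; apply: contraT; rewrite negb_or => /andP[].
move=> /draconianPn[X1 [X10 X1Q N1]] /draconianPn[X2 [X20 X2Q N2]].
(* A set violated by the deletion of [(w, i)] contains [i], but no other element [a] joined to [w],
   through which [w] would remain a neighbour. *)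
have viol w i a X : (w, a) \in R -> a != i -> X != set0 -> X \subset Q ->
    (#|nbr (R :\ (w, i)) X| <= \sum_(e in X) f e)%N ->
    (i \in X) && (a \notin X).
  move=> waR ne X0 XQ leX; have := DR X X0 XQ.
  apply: contraTT; rewrite negb_and negbK -leqNgt => /orP[iX|aX].
    by rewrite -(nbrD1 R w iX).
  apply: leq_trans leX; apply/subset_leq_card/subsetP => v /nbrP[e eX veR].
  have [[-> _]|ne'] := eqVneq (v, e) (w, i).
    by apply: (mem_nbr aX); rewrite in_setD1 waR xpair_eqE (negPf ne) andbF.
  by apply: (mem_nbr eX); rewrite in_setD1 ne'.
have /andP[e1X1 e2X1] : (e1 \in X1) && (e2 \notin X1).
  by apply: (viol v1); rewrite // eq_sym.
have /andP[e2X2 e1X2] : (e2 \in X2) && (e1 \notin X2) by apply: (viol v2).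
pose M1 := nbr (R :\ (v1, e1)) X1; pose M2 := nbr (R :\ (v2, e2)) X2.
have U0 : X1 :|: X2 != set0 by apply/set0Pn; exists e1; rewrite inE e1X1.
have UQ : X1 :|: X2 \subset Q by rewrite subUset X1Q.
have leU : (#|nbr R (X1 :|: X2)| <= #|M1 :|: M2|)%N.
  apply/subset_leq_card; rewrite nbrU; apply/subsetP => v; rewrite !inE.
  case/orP=> /nbrP[e eX veR].
    have [[-> _]|ne] := eqVneq (v, e) (v1, e1).
      apply/orP; right; apply: (mem_nbr e2X2).
      by rewrite in_setD1 v12 xpair_eqE (negPf ne_v).
    by apply/orP; left; apply: (mem_nbr eX); rewrite in_setD1 ne.
  have [[-> _]|ne] := eqVneq (v, e) (v2, e2).
    apply/orP; left; apply: (mem_nbr e1X1).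
    by rewrite in_setD1 v21 xpair_eqE eq_sym (negPf ne_v).
  by apply/orP; right; apply: (mem_nbr eX); rewrite in_setD1 ne.
have leI : (\sum_(e in X1 :&: X2) f e <= #|M1 :&: M2|)%N.
  have [->|I0] := eqVneq (X1 :&: X2) set0; first by rewrite big_set0.
  have IQ : X1 :&: X2 \subset Q by apply: subset_trans X1Q; apply: subsetIl.
  apply: ltnW; apply: leq_trans (DR _ I0 IQ) _; apply/subset_leq_card/subsetP => v.
  case/nbrP=> e; rewrite inE => /andP[eX1 eX2] veR; rewrite inE.
  apply/andP; split; [apply: (mem_nbr eX1)|apply: (mem_nbr eX2)];
    rewrite in_setD1 veR andbT; apply/eqP => -[_ ee].
    by rewrite -ee eX2 in e1X2.
  by rewrite -ee eX1 in e2X1.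
have := DR _ U0 UQ; have := sum_setUI f X1 X2; have := cardsUI M1 M2.
by move: N1 N2 leU leI; rewrite -/M1 -/M2; clear; lia.
Qed.

End Square.

(* Iterated differences: [delta phi s R] is the alternating sum of [phi] over
   the sets obtained from [R] by deleting some of the elements of [s]. *)
Definition del1 (p : V * E) (phi : {set V * E} -> int) R : int :=
  phi R - phi (R :\ p).
Definition delta (phi : {set V * E} -> int) (s : seq (V * E)) :=
  foldr del1 phi s.

Lemma delta_cons phi p s R :
  delta phi (p :: s) R = delta phi s R - delta phi s (R :\ p).
Proof. by []. Qed.

Lemma delta_del1 phi s p R : delta (del1 p phi) s R = delta phi (p :: s) R.
Proof.
elim: s R => //= q s IH R; rewrite /del1 -!/(delta _ _) !IH /= /del1.
by rewrite setDDl (setUC [set q]) -setDDl; ring.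
Qed.

Lemma delta_swap phi p q s R : delta phi (p :: q :: s) R = delta phi (q :: p :: s) R.
Proof.
by rewrite /= /del1 !setDDl (setUC [set q]); ring.
Qed.

(** Monotonicity, [draconian_square_or] and [draconian_square_and] leave only quadruples of truth
    values whose mixed difference vanishes. *)
Lemma square_delta R v1 v2 e1 e2 :
  (v2, e1) \in R -> (v1, e2) \in R -> v1 != v2 -> e1 != e2 ->
  delta (fun S => (D S)%:R) [:: (v1, e1); (v2, e2)] R = 0.
Proof.
move=> v21 v12 nv ne.
have Hor := draconian_square_or v21 v12 nv ne.
have Hand := draconian_square_and v21 nv ne.
have S1 : D (R :\ (v1, e1)) -> D R by apply/draconianS/subD1set.
have S2 : D (R :\ (v2, e2)) -> D R by apply/draconianS/subD1set.
have S12 : D (R :\ (v1, e1) :\ (v2, e2)) -> D (R :\ (v1, e1)).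
  by apply/draconianS/subD1set.
have S21 : D (R :\ (v1, e1) :\ (v2, e2)) -> D (R :\ (v2, e2)).
  by rewrite setDDl setUC -setDDl; apply/draconianS/subD1set.
rewrite /= /del1; move: Hor Hand S1 S2 S12 S21.
do 4 case: (D _) => //=; move=> *; (do ?[by ring]); exfalso; auto.
all: by have := Hor isT.
Qed.

(* Reading a cycle as the sequence of the ends of the epsilons, consecutive
   pairs are linked by the deltas. *)
Definition link R (p q : V * E) := (q.1, p.2) \in R.

(** Meant for a chord [c] whose presence [phi] does not notice as long as [a] and [b] are there: the
    deletions along [s] remove none of the three. *)
Lemma delta_congr (phi : {set V * E} -> int) (c a b : V * E) s R :
  (forall R, a \in R -> b \in R -> phi (c |: R) = phi R) ->
  c \notin s -> a \notin s -> b \notin s -> a \in R -> b \in R ->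
  delta phi s (c |: R) = delta phi s R.
Proof.
move=> Hphi; elim: s R => [|p s IH] R /=; first by move=> *; apply: Hphi.
rewrite !inE !negb_or => /andP[cp cs] /andP[ap as'] /andP[bp bs] aR bR.
rewrite /del1 -!/(delta _ _); congr (_ - _); first exact: IH.
have -> : (c |: R) :\ p = c |: (R :\ p).
  rewrite setDUl; congr (_ :|: _); apply/setP => x; rewrite !inE.
  by case: eqVneq => // ->; rewrite (eq_sym p) (negPf cp).
by apply: IH => //; rewrite in_setD1 ?ap ?bp.
Qed.

Arguments delta : simpl never.

(** Induction on the length by means of the chord [c = (v2, e0)]. Because of the 4-cycle through [c]
    and [(v1, e1)], the difference in [(v1, e1)] does not depend on [c], so [c] may be added to [R];
    there it serves as a delta of a cycle with one epsilon less. *)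
Lemma cycle_delta (p : V * E) s R :
  s != [::] -> uniq (map fst (p :: s)) -> uniq (map snd (p :: s)) ->
  cycle (link R) (p :: s) ->
  delta (fun S => (D S)%:R) (p :: s) R = 0.
Proof.
set phi := (fun S => _).
elim: {s}(size s) {-2}s (leqnn (size s)) p R => [|k IH] [|[v1 e1] s] // le_s [v0 e0] R _.
case: s le_s => [|[v2 e2] s] le_s.
  by rewrite /= /link /= !inE !andbT => nv ne /andP[] *; apply: square_delta.
move=> uV uE /and3P[d0 d1 cyc]; rewrite /link /= in d0 d1.
(* The difference in [(v1, e1)] is absorbed into the function, leaving the differences along the
   epsilons of the shorter cycle outside. *)
rewrite delta_swap -delta_del1.
have := uV; have := uE; rewrite /= !inE !negb_or.
case/and4P=> /and3P[e01 e02 e0s] /andP[e12 e1s] e2s uEs.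
case/and4P=> /and3P[v01 v02 v0s] /andP[v12 v1s] v2s uVs.
pose c := (v2, e0).
(* Apart from [c], the deltas of the shorter cycle have E-ends other than [e1], so they survive the
   deletion of [(v1, e1)]. *)
have short R' : c \in R' -> (forall x, x \in R -> x.2 != e1 -> x \in R') ->
    delta phi [:: (v0, e0), (v2, e2) & s] R' = 0.
  move=> cR' sR'; apply: IH => //=.
  - by rewrite inE negb_or v02 v0s v2s.
  - by rewrite inE negb_or e02 e0s e2s.
  apply/andP; split=> //.
  have : all (fun x => x.2 != e1) ((v2, e2) :: s).
    rewrite /= eq_sym e12 /=; apply/allP => x xs.
    by apply: contraNneq e1s => <-; apply: map_f.
  move: cyc; move: (v2, e2) => y.
  elim: (s) y => [|z t IHt] y /=.
    by rewrite !andbT /link /= => vR ye1; apply: sR'.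
  rewrite /link /= => /andP[zR zt] /andP[ye1 al].
  by rewrite sR' //= IHt.
have notinE x : x.2 \notin map snd s -> x \notin s.
  by apply: contra; apply: map_f.
rewrite -(@delta_congr _ c (v1, e0) (v2, e1)) //.
- rewrite delta_del1 delta_cons.
  rewrite !short ?subrr // ?in_setD1 ?setU11 ?xpair_eqE ?(negPf e01) ?andbF //.
    move=> x xR xe1; rewrite in_setD1 in_setU1 xR orbT andbT.
    by apply: contraNneq xe1 => ->.
  by move=> x xR _; rewrite in_setU1 xR orbT.
(* Unless [c] is already present, the mixed difference in [(v1, e1)] and [c] vanishes on the 4-cycle
   with the deltas [(v1, e0)] and [(v2, e1)]. *)
- move=> S aS bS; have [cS|cS] := boolP (c \in S).
    by rewrite (setUidPr _) ?sub1set.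
  have : delta phi [:: (v1, e1); c] (c |: S) = 0.
    by apply: square_delta; rewrite // ?inE ?aS ?bS ?orbT // eq_sym.
  by rewrite delta_swap delta_cons setU1K // => /subr0_eq.
- by rewrite !inE !xpair_eqE (eq_sym v2 v0) (negPf v02) (negPf e02) !andbF notinE.
- by rewrite !inE !xpair_eqE (eq_sym v1 v0) (negPf v01) (negPf v12) notinE.
- by rewrite !inE !xpair_eqE (eq_sym v2 v0) (negPf v02) (negPf e12) !andbF notinE.
Qed.

End Draconian.
Arguments delta : simpl never.

(** * Alternating sums over subsets, and cyclic sequences *)

Lemma alt_sum_setD1 (T : finType) (A : {set T}) x (g : {set T} -> int) :
  x \in A ->
  \sum_(S : {set T} | S \subset A) (-1) ^+ #|S| * g S =
  \sum_(S : {set T} | S \subset A :\ x) (-1) ^+ #|S| * (g S - g (x |: S)).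
Proof.
move=> xA; under [RHS]eq_bigr do rewrite mulrBr; rewrite big_split /=.
rewrite (bigID (fun S : {set T} => x \in S)) /= addrC; congr (_ + _).
  by apply: eq_bigl => S; rewrite subsetD1.
rewrite (reindex_onto (fun S => x |: S) (fun S => S :\ x)) /=; last first.
  by move=> S /andP[_ xS]; rewrite setD1K.
apply: eq_big => [S|S /andP[_ /eqP]].
  rewrite setU11 andbT subUset sub1set xA subsetD1 /=; congr (_ && _).
  apply/eqP/idP => [<-|xS]; [by rewrite setD11 | exact: setU1K].
move=> /setP/(_ x); rewrite setD11 => xS.
by rewrite cardsU1 -xS exprS !mulNr mul1r.
Qed.

Lemma alt_sum_cone (T : finType) (A : {set T}) x (g : {set T} -> int) :
  x \in A -> (forall S : {set T}, S \subset A :\ x -> g (x |: S) = g S) ->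
  \sum_(S : {set T} | S \subset A) (-1) ^+ #|S| * g S = 0.
Proof.
move=> xA gx; rewrite (alt_sum_setD1 _ xA) big1 // => S /gx ->.
by rewrite subrr mulr0.
Qed.

Lemma cycle_nth (T : Type) (e : rel T) (x0 : T) (s : seq T) :
  (forall i, (i < size s)%N -> e (nth x0 s i) (nth x0 s (i.+1 %% size s))) ->
  cycle e s.
Proof.
case: s => // x s H; apply/(pathP x0) => i; rewrite size_rcons => lti.
have := H i lti; rewrite /= -rcons_cons !nth_rcons /= ltnS.
rewrite ltnS in lti; rewrite lti; move: lti; rewrite leq_eqVlt => /predU1P[->|lt].
  by rewrite ltnn eqxx modnn.
by rewrite lt modn_small.
Qed.

Lemma nth_flatten_pair (T I : Type) (x0 : T) (a b : I -> T) (s : seq I) k :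
  (nth x0 (flatten [seq [:: a i; b i] | i <- s]) k.*2 = nth x0 (map a s) k) *
  (nth x0 (flatten [seq [:: a i; b i] | i <- s]) k.*2.+1 = nth x0 (map b s) k).
Proof.
by elim: s k => [|i s IH] [|k] //=; rewrite IH.
Qed.

Lemma size_flatten_pair (T I : Type) (a b : I -> T) (s : seq I) :
  size (flatten [seq [:: a i; b i] | i <- s]) = (size s).*2.
Proof. by elim: s => //= i s ->. Qed.

(** * The cycle relation for multigraphs *)

Section Pairs.
Variable G : bigraph.
Implicit Types (A S : {set edge G}) (x y : edge G).

Definition ends x : classV G * classE G := (endV x, endE x).
(** Parallel edges collapse here; neighbourhoods depend only on which pairs of vertices are
    joined. *)
Definition pairs A := ends @: A.

Lemma pairsS A A' : A \subset A' -> pairs A \subset pairs A'.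
Proof. exact: imsetS. Qed.

(** No edge of [s] is parallel to any other edge of [G], inside [s] or not; hence deleting the edge
    also deletes its pair. *)
Lemma delta_alt_sum (phi : {set classV G * classE G} -> int) (s : seq (edge G)) A :
  uniq s -> {in s, forall x y, ends x = ends y -> x = y} ->
  delta phi (map ends s) (pairs A) =
  \sum_(S : {set edge G} | S \subset [set x in s]) (-1) ^+ #|S| * phi (pairs (A :\: S)).
Proof.
move=> + H; elim: s A H => [|x s IH] A H /=.
  move=> _; rewrite (big_pred1 set0); first by rewrite cards0 mul1r setD0.
  by move=> S; rewrite /= -subset0; congr (S \subset _); apply/setP => y; rewrite !inE.
move=> /andP[xs us]; rewrite delta_cons.
have -> : pairs A :\ ends x = pairs (A :\ x).
  apply/setP => p; rewrite in_setD1; apply/andP/imsetP => [[px /imsetP[y yA py]]|].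
    by exists y => //; rewrite in_setD1 yA andbT; apply: contraNneq px => <-; apply/eqP.
  case=> y; rewrite in_setD1 => /andP[yx yA] ->; split; last exact: imset_f.
  by apply: contraNneq yx => /esym/H -> //; rewrite mem_head.
have Hs : {in s, forall x y, ends x = ends y -> x = y}.
  by move=> y ys; apply: H; rewrite inE ys orbT.
rewrite !IH // [RHS](@alt_sum_setD1 _ _ x); last by rewrite inE mem_head.
have -> : [set y in x :: s] :\ x = [set y in s].
  by apply/setP => y; rewrite !inE; case: eqVneq => // ->; rewrite (negPf xs).
by rewrite -sumrB; apply: eq_bigr => S _; rewrite mulrBr setDDl.
Qed.

Section Cycle.
Variables (n : nat) (eps del : 'I_n -> edge G).
Hypothesis cyc : is_cycle (flatten [seq [:: eps i; del i] | i <- enum 'I_n]).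

Lemma cycle_pos : (0 < n)%N.
Proof. by case: n eps del cyc => // ??; rewrite enum_ord0. Qed.

(** The vertices along the cycle alternate between the two classes, so the class of the first one
    decides everything. The two alternatives in the last clause are the two directions: the epsilons
    are traversed from V to E, or from E to V. *)
Lemma cycle_ends :
  [/\ injective (fun i => endV (eps i)), injective (fun i => endE (eps i)),
      forall i, eps i != del i &
      (forall i, ends (del i) = (endV (eps (ordS i)), endE (eps i))) \/
      (forall i, ends (del i) = (endV (eps i), endE (eps (ordS i))))].
Proof.
have := cyc; set c := flatten _; case/and3P => _ uc /existsP[p /andP[up /forallP Hp]].
have sc : size c = n.*2 by rewrite size_flatten_pair size_enum_ord.
have n0 := cycle_pos; pose x0 := eps (Ordinal n0).
pose q k := nth (inl (endV x0)) p k.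
have Hq k : (k < n.*2)%N -> joins (nth x0 c k) (q k) (q (k.+1 %% n.*2)%N).
  rewrite -sc => kc; have := Hp (Ordinal kc).
  by rewrite !(tnth_nth x0) !(tnth_nth (inl (endV x0))).
have injq k l : (k < n.*2)%N -> (l < n.*2)%N -> q k = q l -> k = l.
  by move=> kn ln /eqP; rewrite nth_uniq ?size_tuple ?sc // => /eqP.
have sz (i : 'I_n) : (i < size (enum 'I_n))%N.
  by rewrite size_enum_ord; apply: ltn_ord.
have nth_eps (i : 'I_n) : nth x0 c i.*2 = eps i.
  by rewrite nth_flatten_pair (nth_map i _ _ (sz i)) nth_ord_enum.
have nth_del (i : 'I_n) : nth x0 c i.*2.+1 = del i.
  by rewrite nth_flatten_pair (nth_map i _ _ (sz i)) nth_ord_enum.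
pose isl (u : vertex G) := if u is inl _ then true else false.
have jl x u v : joins x u v -> isl v = ~~ isl u.
  by case/orP => /andP[/eqP-> /eqP->].
have par k : (k < n.*2)%N -> isl (q k) = odd k (+) isl (q 0%N).
  elim: k => [//|k IH] kn; have := Hq k (ltnW kn); rewrite modn_small // => /jl ->.
  by rewrite IH 1?ltnW //= addNb.
have ltE (i : 'I_n) : (i.*2 < n.*2)%N by rewrite ltn_double; apply: ltn_ord.
have ltO (i : 'I_n) : (i.*2.+1 < n.*2)%N by have := ltn_ord i; rewrite /=; lia.
have jeps i : joins (eps i) (q i.*2) (q i.*2.+1).
  by have := Hq _ (ltE i); rewrite nth_eps modn_small.
have jdel i : joins (del i) (q i.*2.+1) (q (ordS i).*2).
  have := Hq _ (ltO i); rewrite nth_del; congr (joins _ _ (q _)).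
  by rewrite /= -!muln2 muln_modl ; congr (_ %% _)%N; lia.
have ne i : eps i != del i.
  rewrite -nth_eps -nth_del nth_uniq ?sc //; lia.
have inlP x u v : joins x u v -> isl u -> u = inl (endV x) /\ v = inr (endE x).
  by case/orP => /andP[/eqP-> /eqP->].
have inrP x u v : joins x u v -> ~~ isl u -> u = inr (endE x) /\ v = inl (endV x).
  by case/orP => /andP[/eqP-> /eqP->].
have parE (i : 'I_n) : isl (q i.*2) = isl (q 0%N) by rewrite (par _ (ltE i)) odd_double.
have parO (i : 'I_n) : isl (q i.*2.+1) = ~~ isl (q 0%N).
  by rewrite (par _ (ltO i)) oddS odd_double.
have dbl (i j : 'I_n) : i.*2 = j.*2 -> i = j.
  by move=> ij; apply: val_inj; apply: double_inj.
have [l0|l0] := boolP (isl (q 0%N)).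
  have E (i : 'I_n) : q i.*2 = inl (endV (eps i)) /\ q i.*2.+1 = inr (endE (eps i)).
    by apply: inlP => //; rewrite parE.
  have O (i : 'I_n) :
      q i.*2.+1 = inr (endE (del i)) /\ q (ordS i).*2 = inl (endV (del i)).
    by apply: inrP => //; rewrite parO negbK.
  split=> // [i j /= eij|i j /= eij|].
  - by apply: dbl; apply: injq => //; rewrite (E i).1 (E j).1 eij.
  - by apply: dbl; apply: succn_inj; apply: injq => //; rewrite (E i).2 (E j).2 eij.
  left=> i; have [Oi1 Oi2] := O i; rewrite (E i).2 in Oi1; rewrite (E _).1 in Oi2.
  by case: Oi1 Oi2 => e1 [e2]; rewrite /ends e1 e2.
have E (i : 'I_n) : q i.*2 = inr (endE (eps i)) /\ q i.*2.+1 = inl (endV (eps i)).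
  by apply: inrP => //; rewrite parE.
have O (i : 'I_n) : q i.*2.+1 = inl (endV (del i)) /\ q (ordS i).*2 = inr (endE (del i)).
  by apply: inlP => //; rewrite parO.
split=> // [i j /= eij|i j /= eij|].
- by apply: dbl; apply: succn_inj; apply: injq => //; rewrite (E i).2 (E j).2 eij.
- by apply: dbl; apply: injq => //; rewrite (E i).1 (E j).1 eij.
right=> i; have [Oi1 Oi2] := O i; rewrite (E i).2 in Oi1; rewrite (E _).1 in Oi2.
by case: Oi1 Oi2 => e1 [e2]; rewrite /ends e1 e2.
Qed.

Lemma cycle_alt_sum Q f :
  \sum_(S : {set edge G} | S \subset [set eps i | i : 'I_n])
    (-1) ^+ #|S| * (draconian (pairs (~: S)) Q f)%:R = 0 :> int.
Proof.
have [injV injE ne_eps links] := cycle_ends.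
pose phi (R : {set classV G * classE G}) : int := (draconian R Q f)%:R.
pose l := [seq eps i | i <- enum 'I_n].
have mem_l x : (x \in l) = (x \in [set eps i | i : 'I_n]).
  by apply/mapP/imsetP => -[i _ ->]; exists i; rewrite ?mem_enum.
have size_l : size l = n by rewrite size_map size_enum_ord.
(* Deleting an epsilon parallel to an edge outside the epsilons leaves the set of pairs unchanged,
   so in that case the terms cancel two by two. *)
have [/existsP[i /existsP[y /andP[yeps /eqP eqy]]]|] :=
  boolP [exists i, [exists y, (y \notin [set eps i | i : 'I_n])
                               && (ends (eps i) == ends y)]].
  apply: (@alt_sum_cone _ _ (eps i)) => [|S SA]; first exact: imset_f.
  suff E : pairs (~: (eps i |: S)) = pairs (~: S) by rewrite E.
  apply/eqP; rewrite eqEsubset.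
  apply/andP; split; first by apply: pairsS; rewrite setCS subsetUr.
  apply/subsetP => p /imsetP[x]; rewrite inE => xS ->.
  have [->|xi] := eqVneq x (eps i); last first.
    by apply: imset_f; rewrite !inE negb_or xi.
  rewrite eqy; apply: imset_f; rewrite !inE negb_or.
  apply/andP; split; first by apply: contraNneq yeps => ->; apply: imset_f.
  by apply: contra yeps => /(subsetP SA); rewrite inE => /andP[].
rewrite negb_exists => /forallP nopar.
have inj_l : {in l, forall x y, ends x = ends y -> x = y}.
  move=> x; rewrite mem_l => /imsetP[i _ ->] y eqy.
  have [/imsetP[j _ yj]|yl] := boolP (y \in [set eps i | i : 'I_n]).
    by move: eqy; rewrite yj => -[/injV ->].
  have := nopar i; rewrite negb_exists => /forallP/(_ y).
  by rewrite yl eqy eqxx.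
have uniq_l : uniq l.
  by rewrite map_inj_uniq ?enum_uniq // => i j eij; apply: injV; rewrite eij.
(* A single epsilon would be parallel to its delta. *)
have n1 : (1 < n)%N.
  rewrite ltnNge; apply/negP => le_n1.
  have eqS (i : 'I_n) : ordS i = i.
    by apply: ord_inj; move: (ltn_ord i) (ltn_ord (ordS i)); lia.
  pose i0 := Ordinal cycle_pos.
  have ee : ends (eps i0) = ends (del i0) by case: links => ->; rewrite eqS.
  have := ne_eps i0; rewrite (inj_l (eps i0) _ _ ee) ?eqxx //.
  by rewrite mem_l imset_f.
(* The order of the list is left open: the direction of the cycle decides between [l] and its
   reverse. *)
suff [l' lE H0] : exists2 l', perm_eq l' l & delta phi (map ends l') (pairs setT) = 0.
  have El' : [set x in l'] = [set eps i | i : 'I_n].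
    by apply/setP => x; rewrite inE (perm_mem lE) mem_l.
  rewrite -[RHS]H0 delta_alt_sum ?(perm_uniq lE) //.
    by rewrite El'; apply: eq_bigr => S _; rewrite setTD.
  by move=> x xl'; apply: inj_l; rewrite -(perm_mem lE).
have Rdel i : ends (del i) \in pairs setT by apply: imset_f.
have main l' : perm_eq l' l -> cycle (link (pairs setT)) (map ends l') ->
    delta phi (map ends l') (pairs setT) = 0.
  move=> lE; have : size (map ends l') = n by rewrite size_map (perm_size lE).
  have : uniq (map fst (map ends l')).
    rewrite -map_comp (perm_uniq (perm_map _ lE)) -map_comp.
    by rewrite map_inj_uniq ?enum_uniq.
  have : uniq (map snd (map ends l')).
    rewrite -map_comp (perm_uniq (perm_map _ lE)) -map_comp.
    by rewrite map_inj_uniq ?enum_uniq.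
  case: (map ends l') => [|p [|q s]]; try by move=> _ _ /=; lia.
  by move=> *; apply: cycle_delta.
pose x0 := eps (Ordinal cycle_pos).
have nth_l k (kn : (k < n)%N) : nth (ends x0) (map ends l) k = ends (eps (Ordinal kn)).
  rewrite (nth_map x0) ?size_l // (nth_map (Ordinal kn)) ?size_enum_ord //.
  by congr (ends (eps _)); apply: val_inj; rewrite /= nth_enum_ord.
have nth_lS k (kn : (k < n)%N) : 
    nth (ends x0) (map ends l) (k.+1 %% n) = ends (eps (ordS (Ordinal kn))).
  by rewrite nth_l ?ltn_pmod ?cycle_pos // => H; congr (ends (eps _)); apply: val_inj.
case: links => dE.
  exists l => //; apply: main => //; apply: (@cycle_nth _ _ (ends x0)).
  rewrite size_map size_l => k kn; rewrite (nth_l k kn) (nth_lS k kn) /link /=.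
  by rewrite -dE.
exists (rev l); first by rewrite perm_rev.
apply: main; first by rewrite perm_rev.
rewrite map_rev rev_cycle; apply: (@cycle_nth _ _ (ends x0)).
rewrite size_map size_l => k kn; rewrite (nth_l k kn) (nth_lS k kn) /link /=.
by rewrite -dE.
Qed.

End Cycle.
End Pairs.

(** * Bases and activities *)

Lemma sum_eq_mem (T : finType) (X : {set T}) e (w : T -> nat) :
  (\sum_(a in X) (a == e) * w a = (e \in X) * w e)%N.
Proof.
rewrite (eq_bigr (fun a => if a == e then w a else 0)%N); last first.
  by move=> a _; case: eqP; rewrite ?mul1n ?mul0n.
rewrite -big_mkcondr /=; have [eX|eX] := boolP (e \in X).
  by rewrite mul1n (big_pred1 e) // => a /=; case: eqVneq => [->|]; rewrite ?eX ?andbF.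
by rewrite big_pred0 // => a; apply/andP=> -[aX /eqP ae]; rewrite -ae aX in eX.
Qed.

(** Moving a unit from [e] to [e'] is expressed by adding units on both sides, which avoids
    truncated subtraction. The factor [w] covers both plain sums and sums weighted by the rank. *)
Lemma eq_sum_shift (T : finType) (X : {set T}) e e' (f g w : T -> nat) :
  (forall a, g a + (a == e) = f a + (a == e'))%N ->
  (\sum_(a in X) g a * w a + (e \in X) * w e =
   \sum_(a in X) f a * w a + (e' \in X) * w e')%N.
Proof.
move=> H; rewrite -!sum_eq_mem -!big_split /=.
by apply: eq_bigr => a _; rewrite -!mulnDl H.
Qed.

Section Bases.
Variables (G : bigraph) (R : {set classV G * classE G}) (Q : {set classE G}).
Implicit Types (X Y : {set classE G}) (e : classE G) (f g h : classE G -> nat).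

Definition base f : bool :=
  [&& [forall e, (e \notin Q) ==> (f e == 0%N)], draconian R Q f
    & (\sum_(e in Q) f e).+1 == #|nbr R Q|].

Lemma baseP f :
  reflect [/\ forall e, e \notin Q -> f e = 0%N, draconian R Q f
            & (\sum_(e in Q) f e).+1 = #|nbr R Q| ] (base f).
Proof.
apply: (iffP and3P) => -[Hs D]; move/eqP => S; split=> //.
  by move=> e eQ; have /forallP/(_ e) := Hs; rewrite eQ => /eqP.
by apply/forallP => e; apply/implyP => /Hs ->.
Qed.

Definition tight f X : bool :=
  [&& X != set0, X \subset Q & #|nbr R X| == (\sum_(e in X) f e).+1].

(** Uncrossing by submodularity of |N(X)|. When X and Y are disjoint, a common neighbour replaces
    the strict inequality for the intersection. *)
Lemma tightU f X Y :
  draconian R Q f -> tight f X -> tight f Y -> ~~ [disjoint nbr R X & nbr R Y] ->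
  tight f (X :|: Y).
Proof.
move=> /draconianP D /and3P[X0 XQ /eqP tX] /and3P[Y0 YQ /eqP tY] nd.
have U0 : X :|: Y != set0.
  by apply: contraNneq X0 => U0; rewrite -subset0 -U0 subsetUl.
have UQ : X :|: Y \subset Q by rewrite subUset XQ.
apply/and3P; split=> //; rewrite eqn_leq D // andbT nbrU.
have := cardsUI (nbr R X) (nbr R Y); have := sum_setUI f X Y.
suff : (\sum_(e in X :&: Y) f e < #|nbr R X :&: nbr R Y|)%N by lia.
have [->|I0] := eqVneq (X :&: Y) set0.
  by rewrite big_set0 card_gt0 setI_eq0.
apply: leq_trans (D _ I0 (subset_trans (subsetIl X Y) XQ)) _.
by apply: subset_leq_card; rewrite subsetI !nbrS ?subsetIl ?subsetIr.
Qed.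

(** The same count with the roles of union and intersection exchanged. *)
Lemma tightI f X Y :
  draconian R Q f -> tight f X -> tight f Y -> X :&: Y != set0 ->
  tight f (X :&: Y).
Proof.
move=> /draconianP D /and3P[X0 XQ /eqP tX] /and3P[Y0 YQ /eqP tY] I0.
have U0 : X :|: Y != set0.
  by apply: contraNneq X0 => U0; rewrite -subset0 -U0 subsetUl.
have UQ : X :|: Y \subset Q by rewrite subUset XQ.
have IQ := subset_trans (subsetIl X Y) XQ.
apply/and3P; split=> //; rewrite eqn_leq D // andbT.
have leI : (#|nbr R (X :&: Y)| <= #|nbr R X :&: nbr R Y|)%N.
  by apply: subset_leq_card; rewrite subsetI !nbrS ?subsetIl ?subsetIr.
have := D _ U0 UQ; rewrite nbrU.
have := cardsUI (nbr R X) (nbr R Y); have := sum_setUI f X Y; lia.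
Qed.

Lemma sum_shift X e e' f g :
  (forall a, g a + (a == e) = f a + (a == e'))%N ->
  (\sum_(a in X) g a + (e \in X) = \sum_(a in X) f a + (e' \in X))%N.
Proof.
move/(eq_sum_shift X (fun=> 1%N)); rewrite !muln1.
by under eq_bigr do rewrite muln1; under [X in _ = (X + _)%N]eq_bigr do rewrite muln1.
Qed.

Lemma transfer_shift f e e' : (0 < f e)%N -> e' != e ->
  forall a, (transfer f e e' a + (a == e) = f a + (a == e'))%N.
Proof.
move=> fe ne a; rewrite /transfer; have [->|ae] := eqVneq a e.
  by rewrite eq_sym (negPf ne) addn1 addn0 prednK.
by case: ifP => _; rewrite addn0 ?addn1 ?addn0.
Qed.

(** Tight sets of [f1] containing [e'] are closed under intersection and include [Q], so there is a
    smallest one. Any [e] in it lies in every tight set containing [e'], and a unit can be moved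
    from [e] to [e'] without violating a bound. *)
Lemma base_exchange f1 f2 e' :
  base f1 -> base f2 -> (f1 e' < f2 e')%N ->
  exists e, [/\ (f2 e < f1 e)%N, e' != e & base (transfer f1 e e')].
Proof.
move=> /baseP[s1 D1 t1] /baseP[s2 D2 t2] lt12.
have e'Q : e' \in Q by apply: contraLR lt12 => /s2 ->.
have tQ : tight f1 Q && (e' \in Q).
  rewrite e'Q andbT; apply/and3P; split; rewrite ?t1 //.
  by apply/set0Pn; exists e'.
pose P X := tight f1 X && (e' \in X).
case: (@arg_minnP _ Q P (fun X => #|X|) tQ) => X /andP[tX e'X] minX.
have subX Y : tight f1 Y -> e' \in Y -> X \subset Y.
  move=> tY e'Y; apply/setIidPl/eqP; rewrite eqEcard subsetIl minX //.
  rewrite /P inE e'X e'Y !andbT; apply: tightI => //.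
  by apply/set0Pn; exists e'; rewrite inE e'X.
(* As [X] is tight for [f1], the sum of [f2] over [X] cannot exceed that of [f1]; the surplus of
   [f2] at [e'] is made up for inside [X]. *)
have [e eX lt21] : exists2 e, e \in X & (f2 e < f1 e)%N.
  apply/exists_inP; apply: contraLR tX; rewrite negb_exists_in => /forall_inP H.
  apply/negP => /and3P[X0 XQ /eqP tX].
  have /draconianP/(_ X X0 XQ) := D2; rewrite tX ltnS leqNgt => /negP[].
  rewrite (big_setD1 e') //= [X in (_ < X)%N](big_setD1 e') //=.
  rewrite -addSn leq_add //; apply: leq_sum => a; rewrite inE => /andP[_ /H].
  by rewrite -leqNgt.
have ne : e' != e by apply: contraTneq lt21 => <-; rewrite -leqNgt ltnW.
have sh := transfer_shift (leq_ltn_trans (leq0n _) lt21) ne.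
have eQ : e \in Q by case/and3P: tX => _ /subsetP/(_ e eX).
exists e; split=> //; apply/baseP; split.
- move=> a aQ; have := sh a; rewrite s1 //.
  have [ae|_] := eqVneq a e'; first by rewrite ae e'Q in aQ.
  by move/eqP; rewrite addn_eq0 => /andP[/eqP].
- apply/draconianP => Y Y0 YQ; have := sum_shift Y sh.
  have /draconianP/(_ Y Y0 YQ) := D1.
  have [e'Y|_] := boolP (e' \in Y); last by clear; lia.
  have [_|eY] := boolP (e \in Y); first by clear; lia.
  suff : #|nbr R Y| != (\sum_(a in Y) f1 a).+1 by clear; lia.
  apply: contra eY => tY; apply: (subsetP (subX Y _ e'Y)) => //.
  by rewrite /tight Y0 YQ.
- by rewrite -t1; have := sum_shift Q sh; rewrite e'Q eQ; clear; lia.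
Qed.

Hypothesis Q_conn : forall X, X != set0 -> X \proper Q ->
  exists2 e, e \in Q :\: X & ~~ [disjoint nbr R [set e] & nbr R X].
Hypothesis Q_nonempty : Q != set0.

(** An element in no tight set can be raised by one. If every element lies in a tight set, a largest
    tight set is [Q]: by connectedness, an element outside shares a neighbour with it, and the tight
    set of that element could be merged in. *)
Lemma base_extend f :
  draconian R Q f -> (forall e, e \notin Q -> f e = 0%N) ->
  exists2 g, base g & forall e, (f e <= g e)%N.
Proof.
elim: {f}_.+1 {-2}f (ltnSn (#|nbr R Q| - \sum_(e in Q) f e)%N) => // k IH f le_k D sf.
have [e0 e0Q] := set0Pn _ Q_nonempty.
have DQ : (\sum_(e in Q) f e < #|nbr R Q|)%N by have /draconianP := D; apply.
have [bf|nb] := boolP (base f); first by exists f.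
have [e /andP[eQ nt]] : exists e, (e \in Q) && ~~ [exists X, tight f X && (e \in X)].
  apply/existsP; apply: contraNT nb; rewrite negb_exists => /forallP H.
  have tE e : e \in Q -> exists2 X, tight f X & e \in X.
    by move=> eQ; have := H e; rewrite eQ negbK => /existsP[X /andP[]]; exists X.
  have [X0 tX0 _] := tE _ e0Q.
  case: (@arg_maxnP _ X0 (tight f) (fun X => #|X|) tX0) => X tX maxX.
  have [XQ|] := boolP (X \proper Q); last first.
    case/and3P: (tX) => _ XQ tQ; rewrite properEneq XQ andbT negbK => /eqP eXQ.
    by apply/baseP; split=> //; apply/esym/eqP; rewrite -eXQ.
  have [Xn0 _ _] := and3P tX.
  have [e] := Q_conn Xn0 XQ; rewrite inE => /andP[eX eQ] nd.
  have [Y tY eY] := tE _ eQ.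
  have : (#|Y :|: X| <= #|X|)%N.
    apply/maxX/tightU => //; apply: contra nd; apply: disjointWl.
    by apply: nbrS; rewrite ?sub1set.
  move/(conj (subsetUr Y X))/andP; rewrite -eqEcard => /eqP eXU.
  by rewrite eXU inE eY in eX.
pose g a := (f a + (a == e))%N.
have sumg X : (\sum_(a in X) g a = \sum_(a in X) f a + (e \in X))%N.
  rewrite big_split /=; congr (_ + _)%N.
  have := sum_eq_mem X e (fun=> 1%N); rewrite muln1 => <-.
  by apply: eq_bigr => a; rewrite muln1.
have [|||b bb le_gb] := IH g.
- by rewrite sumg eQ; move: DQ le_k; lia.
- apply/draconianP => X X0 XQ; rewrite sumg.
  have /draconianP/(_ X X0 XQ) := D; have [eX|] := boolP (e \in X); last by clear; lia.
  suff : #|nbr R X| != (\sum_(a in X) f a).+1 by clear; lia.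
  apply: contra nt => tX; apply/existsP; exists X.
  by rewrite eX /tight X0 XQ tX.
- move=> a aQ; rewrite /g sf //; apply/eqP; rewrite eqb0.
  by apply: contraNneq aQ => ->.
by exists b => // a; apply: leq_trans (le_gb a); rewrite leq_addr.
Qed.

Variable leE : rel (classE G).
Hypotheses (leE_total : total leE) (leE_anti : antisymmetric leE).
Hypothesis leE_trans : transitive leE.

Definition inactive f e : bool :=
  (e \in Q) && [exists e', [&& e' \in Q, leE e' e, e' != e, (0 < f e)%N
                             & base (transfer f e e')]].

Definition box f h : bool :=
  [forall e, if e \in Q then
               if inactive f e then h e == (f e).+1 else (h e <= (f e).+1)%N
             else h e == 0%N].

Definition degrees h : bool := draconian R [set e | (0 < h e)%N] (fun e => (h e).-1).

Let rank e := #|[set a | leE a e]|.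

Lemma rank_lt e' e : leE e' e -> e' != e -> (rank e' < rank e)%N.
Proof.
move=> le ne; apply: proper_card; apply/properP; split.
  by apply/subsetP => a; rewrite !inE => /leE_trans; apply.
exists e; rewrite !inE; first by have := leE_total e e; rewrite orbb.
by apply: contra ne => le'; apply/eqP/leE_anti; rewrite le.
Qed.

Lemma box_exists h :
  (forall e, e \in Q -> nbr R [set e] != set0) ->
  (forall e, e \notin Q -> h e = 0%N) -> degrees h -> exists2 f, base f & box f h.
Proof.
move=> nbr1 sh /draconianP Dh.
(* Elements with [h e = 0] add nothing to the sum, and a set of such elements alone satisfies the
   strict inequality because it has a neighbour. *)
have Dg : draconian R Q (fun e => (h e).-1).
  apply/draconianP => X X0 XQ; rewrite (big_setID [set e | (0 < h e)%N]) /=.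
  rewrite [X in (_ + X)%N]big1 ?addn0; last first.
    by move=> e; rewrite !inE; case: (h e).
  have [->|I0] := eqVneq (X :&: [set e | (0 < h e)%N]) set0.
    have [e eX] := set0Pn _ X0; rewrite big_set0 card_gt0.
    have [v ve] := set0Pn _ (nbr1 e (subsetP XQ e eX)); apply/set0Pn; exists v.
    by apply: subsetP ve; apply: nbrS; rewrite // sub1set.
  apply: leq_trans (Dh _ I0 (subsetIr _ _)) _.
  by apply/subset_leq_card/nbrS; rewrite ?subsetIl.
have [e /sh ->//|f0 bf0 le_f0] := base_extend Dg.
(* A base above [h - 1] of minimal weight: a transfer at an inactive element
   would decrease the weight. *)
pose weight f := (\sum_(e in Q) f e * rank e)%N.
elim: {f0}_.+1 {-2}f0 (ltnSn (weight f0)) bf0 le_f0 => // k IH f le_k bf le_f.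
have [|] := boolP (box f h); first by exists f.
rewrite negb_forall => /existsP[e]; have [_ sf _] := baseP _ bf.
case: ifP => eQ; last by rewrite sh ?eQ.
case: ifP => [|_]; last by move: (le_f e); clear; lia.
rewrite /inactive eQ /= => /existsP[e' /and5P[e'Q lee ne fe bt]] hne.
have sht := transfer_shift fe ne.
apply: (IH _ _ bt) => [|a].
  have := eq_sum_shift Q rank sht; rewrite eQ e'Q -!/(weight _).
  by move: (rank_lt lee ne) le_k; clear; lia.
have := sht a; have := le_f a; have [->|_] := eqVneq a e; last by clear; lia.
by rewrite eq_sym (negPf ne); move: (le_f e) hne fe; clear; lia.
Qed.

Lemma box_degrees f h : base f -> box f h -> degrees h.
Proof.
move=> /baseP[_ /draconianP D _] /forallP bh; apply/draconianP => X X0 sX.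
have hQ e : (0 < h e)%N -> e \in Q.
  by have := bh e; case: ifP => // _ /eqP ->.
have le_h e : ((h e).-1 <= f e)%N.
  by have := bh e; case: ifP => _; [case: ifP => _|]; clear; lia.
apply: leq_ltn_trans (D X X0 _); first exact: leq_sum.
by apply/subsetP => e /(subsetP sX); rewrite inE => /hQ.
Qed.

Lemma box_uniq f1 f2 h :
  base f1 -> base f2 -> box f1 h -> box f2 h -> f1 =1 f2.
Proof.
move=> b1 b2 x1 x2.
(* If [f e' < g e'], the exchanged element is smaller than [e'] because it
   would otherwise be inactive in [f]; hence there is no smallest difference. *)
have first_diff f g : base f -> base g -> box f h -> box g h ->
    forall e', (f e' < g e')%N ->
    exists2 e, f e != g e & (rank e < rank e')%N.
  move=> bf bg /forallP xf /forallP xg e' lt.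
  have [e [lte ne bt]] := base_exchange bf bg lt.
  exists e; first by rewrite gtn_eqF.
  have [_ _ _] := baseP _ bf; have [sf _ _] := baseP _ bf.
  have eQ : e \in Q by apply: contraLR lte => /sf ->.
  have e'Q : e' \in Q.
    by have [sg _ _] := baseP _ bg; apply: contraLR lt => /sg ->.
  have [lee|lee] := orP (leE_total e' e); last by apply: rank_lt; rewrite 1?eq_sym.
  have ie : inactive f e.
    rewrite /inactive eQ; apply/existsP; exists e'.
    by rewrite e'Q lee ne bt (leq_ltn_trans _ lte).
  have := xf e; have := xg e; rewrite eQ ie.
  by case: ifP => _; move: lte; clear; lia.
move=> e; apply/eqP.
elim: {e}_.+1 {-2}e (ltnSn (rank e)) => // k IH e le_k.
apply: contraT; rewrite neq_ltn => /orP[] lt.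
  have [a ne lta] := first_diff _ _ b1 b2 x1 x2 e lt.
  by rewrite IH // in ne; apply: leq_trans lta _.
have [a ne lta] := first_diff _ _ b2 b1 x2 x1 e lt.
by rewrite eq_sym IH // in ne; apply: leq_trans lta _.
Qed.

End Bases.

Section Ext.
Variables (G : bigraph) (R : {set classV G * classE G}) (Q : {set classE G}).
Variable leE : rel (classE G).

Lemma eq_draconian f g : f =1 g -> draconian R Q f = draconian R Q g.
Proof.
by move=> fg; apply: eq_forallb => X; congr (_ ==> (_ < _)%N); apply: eq_bigr.
Qed.

Lemma eq_base f g : f =1 g -> base R Q f = base R Q g.
Proof.
move=> fg; rewrite /base (eq_draconian fg); congr [&& _, _ & _].
  by apply: eq_forallb => e; rewrite fg.
by congr (_.+1 == _); apply: eq_bigr.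
Qed.

Lemma eq_inactive f g : f =1 g -> inactive R Q leE f =1 inactive R Q leE g.
Proof.
move=> fg e; congr (_ && _); apply: eq_existsb => e'; rewrite fg.
by rewrite (@eq_base _ (transfer g e e')) // => a; rewrite /transfer !fg.
Qed.

Lemma eq_box f g h : f =1 g -> box R Q leE f h = box R Q leE g h.
Proof.
by move=> fg; apply: eq_forallb => e; rewrite fg (eq_inactive fg).
Qed.

End Ext.

(* Only used for [\sum_e h e <= a], so that the subtraction is exact. *)
Definition weight (T : finType) (a : nat) (h : T -> nat) : {poly int} :=
  'X^#|[set e | (0 < h e)%N]| * (1 - 'X) ^+ (a - \sum_e h e).

(** The contribution of an element that is not inactive to the sum over a box: its coordinate ranges
    freely over 0, ..., k and yields the factor 1. *)
Lemma sum_below (R : comNzRingType) (x : R) k :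
  \sum_(j < k.+1) x ^+ (0 < j)%N * (1 - x) ^+ (k - j) = 1.
Proof.
elim: k => [|k IH]; first by rewrite big_ord1 !mulr1.
rewrite big_ord_recr /= subnn mulr1 expr1.
rewrite (eq_bigr (fun j : 'I_k.+1 => (1 - x) * (x ^+ (0 < j)%N * (1 - x) ^+ (k - j)))).
  by rewrite -mulr_sumr IH; ring.
by move=> j _; rewrite subSn; [rewrite exprS mulrCA | rewrite -ltnS ltn_ord].
Qed.

(** * Summation over boxes *)

Section BoxSum.
Variables (G : bigraph) (R : {set classV G * classE G}) (Q : {set classE G}).
Hypothesis Q_conn : forall X : {set classE G}, X != set0 -> X \proper Q ->
  exists2 e, e \in Q :\: X & ~~ [disjoint nbr R [set e] & nbr R X].
Hypothesis Q_nonempty : Q != set0.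
Variable leE : rel (classE G).
Hypotheses (leE_total : total leE) (leE_anti : antisymmetric leE).
Hypothesis leE_trans : transitive leE.
Hypothesis nbr1 : forall e, e \in Q -> nbr R [set e] != set0.
Variable m : nat.
Hypothesis nbr_le : forall e, e \in Q -> (#|nbr R [set e]| <= m)%N.

(** Leaves room for the value [f e + 1], which occurs in the box of [f]. *)
Lemma base_lt f e : base R Q f -> e \in Q -> ((f e).+1 < m.+1)%N.
Proof.
move=> /baseP[_ /draconianP D _] eQ; rewrite ltnS; apply: leq_trans (nbr_le eQ).
have := D [set e]; rewrite big_set1; apply; rewrite ?sub1set //.
by apply/set0Pn; exists e; rewrite inE.
Qed.

(** A box is a product, so the sum factors: an inactive element yields x, any other element yields
    1. The remaining 1 - x arises because |N(Q)| exceeds the sum of a base by one. *)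
Lemma sum_box (f : classE G -> nat) : base R Q f ->
  \sum_(h : {ffun classE G -> 'I_m.+1} | box R Q leE f (fun e => h e))
     weight (#|nbr R Q| + #|Q|) (fun e => h e) =
  (1 - 'X) * 'X^#|[set e | inactive R Q leE f e]|.
Proof.
move=> bf; have [sf _ tf] := baseP _ _ _ bf.
pose ok e (j : nat) := if e \in Q then
    if inactive R Q leE f e then j == (f e).+1 else (j <= (f e).+1)%N
  else j == 0%N.
pose t e (j : nat) : {poly int} :=
  'X ^+ (0 < j)%N * (1 - 'X) ^+ ((e \in Q) * ((f e).+1 - j)).
transitivity (\sum_(h : {ffun classE G -> 'I_m.+1})
    (1 - 'X) * \prod_e (if ok e (h e) then t e (h e) else 0)).
  rewrite big_mkcond; apply: eq_bigr => h _; case: ifP => bh; last first.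
    move/negbT: bh; rewrite negb_forall => /existsP[e ne].
    by rewrite (bigD1 e) //= /ok (negPf ne) mul0r mulr0.
  move/forallP: bh => bh; rewrite (eq_bigr (fun e => t e (h e))); last first.
    by move=> e _; rewrite /ok bh.
  rewrite big_split /= !prodrXr mulrCA -exprS /weight; congr ('X^_ * _ ^+ _).
    by rewrite -sum1dep_card big_mkcond /=; apply: eq_bigr => e _; case: (0 < h e)%N.
  have le_h e : e \in Q -> (h e <= (f e).+1)%N.
    by move=> eQ; have := bh e; rewrite eQ; case: ifP => _ // /eqP->.
  have -> : (\sum_e (h e : nat) = \sum_(e in Q) h e)%N.
    rewrite [RHS]big_mkcond; apply: eq_bigr => e _.
    by have := bh e; case: ifP => // _ /eqP->.
  rewrite -tf -sum1_card.
  have -> : (\sum_e (e \in Q) * ((f e).+1 - h e) = \sum_(e in Q) ((f e).+1 - h e))%N.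
    by rewrite [RHS]big_mkcond; apply: eq_bigr => e _; case: ifP; rewrite ?mul1n.
  have : (\sum_(e in Q) ((f e).+1 - h e) + \sum_(e in Q) h e
          = \sum_(e in Q) f e + \sum_(e in Q) 1)%N.
    rewrite -!big_split /=; apply: eq_bigr => e eQ.
    by rewrite subnK ?addn1 // le_h.
  clear; lia.
rewrite -mulr_sumr; congr (_ * _).
rewrite -(bigA_distr_bigA (fun e (j : 'I_m.+1) => if ok e j then t e j else 0)) /=.
rewrite -sum1dep_card -prodrXr [RHS]big_mkcond; apply: eq_bigr => e _.
rewrite /ok /t; have [eQ|eQ] := boolP (e \in Q); last first.
  by rewrite /inactive (negPf eQ) -big_mkcond (big_pred1 ord0) ?mulr1.
have lt_f := base_lt bf eQ.
case: ifP => ie; rewrite -big_mkcond /=.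
  by rewrite (big_pred1 (Ordinal lt_f)) //= subnn muln0 mulr1.
rewrite -[RHS](sum_below ('X : {poly int}) (f e).+1).
rewrite (big_ord_widen m.+1 (fun j => 'X ^+ (0 < j)%N * (1 - 'X) ^+ ((f e).+1 - j))) //.
by apply: eq_bigr => j _; rewrite mul1n.
Qed.

Lemma sum_degrees :
  \sum_(h : {ffun classE G -> 'I_m.+1} |
        [forall e, (e \notin Q) ==> (h e == 0%N :> nat)]
        && degrees R (fun e => h e))
     weight (#|nbr R Q| + #|Q|) (fun e => h e) =
  (1 - 'X) * \sum_(f : {ffun classE G -> 'I_m.+1} | base R Q (fun e => f e))
     'X^#|[set e | inactive R Q leE (fun e => f e) e]|.
Proof.
rewrite mulr_sumr; under [RHS]eq_bigr => f bf do rewrite -sum_box //.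
rewrite (exchange_big_dep predT) //= [LHS]big_mkcond.
apply: eq_bigr => h _; case: ifP => [/andP[/forallP sh dh]|ndh].
  have [|f bf bh] := box_exists Q_conn Q_nonempty leE_total leE_anti leE_trans nbr1 _ dh.
    by move=> e eQ; apply/eqP; have := sh e; rewrite eQ.
  have lt_f e : (f e < m.+1)%N.
    have [sf _ _] := baseP _ _ _ bf.
    by have [eQ|/sf->//] := boolP (e \in Q); apply/ltnW/base_lt.
  pose f' := [ffun e => Ordinal (lt_f e)].
  have ef : (fun e => f' e : nat) =1 f by move=> e; rewrite ffunE.
  rewrite (big_pred1 f') // => g; apply/andP/eqP => [[bg xg]|->].
    apply/ffunP => e; apply: val_inj; rewrite ffunE /=.
    exact: (box_uniq leE_total leE_anti leE_trans bg bf xg bh).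
  by rewrite (eq_base _ _ ef) (eq_box _ _ _ _ ef).
rewrite big_pred0 // => f; apply/negP => /andP[bf xf].
move/negP: ndh; apply; rewrite (box_degrees bf xf) andbT.
apply/forallP => e; apply/implyP => eQ.
by move/forallP/(_ e): xf; rewrite (negPf eQ).
Qed.

End BoxSum.

(** * Forests and hypertrees *)

Section Forests.
Variable G : bigraph.
Implicit Types (A B T : {set edge G}) (W Y Z : {set vertex G}) (x y : edge G).

Lemma joins_sym x u v : joins x u v = joins x v u.
Proof. by rewrite /joins orbC ![(_ == inr _) && _]andbC. Qed.

Lemma joins_ends x : joins x (inl (endV x)) (inr (endE x)).
Proof. by rewrite /joins !eqxx. Qed.

Lemma joins_neq x u v : joins x u v -> u != v.
Proof. by case/orP => /andP[/eqP-> /eqP->]. Qed.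

Lemma joins_inj x u v u' v' :
  joins x u v -> joins x u' v' -> (u = u' /\ v = v') \/ (u = v' /\ v = u').
Proof.
by do 2 case/orP => /andP[/eqP-> /eqP->]; auto.
Qed.

Lemma adjacentP A u v : reflect (exists2 x, x \in A & joins x u v) (adjacent A u v).
Proof. exact: exists_inP. Qed.

Lemma adjacent_ends A x : x \in A -> adjacent A (inl (endV x)) (inr (endE x)).
Proof. by move=> xA; apply/adjacentP; exists x => //; apply: joins_ends. Qed.

Lemma adjacent_sym A : symmetric (adjacent A).
Proof. by move=> u v; apply: eq_existsb => x; rewrite joins_sym. Qed.

Lemma connect_adjacent_sym A : connect_sym (adjacent A).
Proof. exact/sym_connect_sym/adjacent_sym. Qed.

(** These sets are the unions of connected components. *)
Definition saturated A Z : bool :=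
  [forall x in A, (inl (endV x) \in Z) == (inr (endE x) \in Z)].

Lemma saturatedP A Z :
  reflect {in A, forall x, (inl (endV x) \in Z) = (inr (endE x) \in Z)}
          (saturated A Z).
Proof. by apply: (iffP forall_inP) => H x xA; apply/eqP; rewrite H. Qed.

Lemma saturated_connect A Z u v :
  saturated A Z -> connect (adjacent A) u v -> (u \in Z) = (v \in Z).
Proof.
move=> /saturatedP sZ; apply: closed_connect => {u v} u v /adjacentP[x xA].
by case/orP => /andP[/eqP-> /eqP->]; rewrite sZ.
Qed.

Lemma connect_saturated A u : saturated A [set v | connect (adjacent A) u v].
Proof.
apply/saturatedP => x xA; rewrite !inE.
exact/(same_connect_r (@connect_adjacent_sym A))/connect1/adjacent_ends.
Qed.

Lemma acyclicS A B : A \subset B -> acyclic B -> acyclic A.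
Proof.
move=> /subsetP sAB /forallP ac; apply/forallP => m; apply/forallP => c.
have /forallP/(_ c)/implyP H := ac m; apply/implyP => cA; apply: H.
by apply/allP => x /(allP cA)/sAB.
Qed.

(** Distinct vertices force distinct edges: the edge leaving [u] has an end that is not on the rest
    of the path. The clause on ends carries this through the induction. *)
Lemma path_edges A u p :
  path (adjacent A) u p -> uniq (u :: p) ->
  exists s : seq (edge G), [/\ size s = size p, {subset s <= A}, uniq s,
    (forall y a b, y \in s -> joins y a b -> (a \in u :: p) && (b \in u :: p)) &
    forall y0 i, (i < size p)%N ->
      joins (nth y0 s i) (nth u (u :: p) i) (nth u p i)].
Proof.
elim: p u => [|v p IH] u; first by move=> _ _; exists [::]; split.
rewrite [path _ _ _]/= cons_uniq => /andP[/adjacentP[x xA jx] /IH{}IH] /andP[uvp].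
case/IH => s [sz sA us sends sj]; exists (x :: s); split.
- by rewrite /= sz.
- by move=> y; rewrite inE => /predU1P[->|/sA].
- rewrite /= us andbT; apply: contra uvp => /sends/(_ jx)/andP[].
  by rewrite [_ \in v :: p]inE.
- move=> y a b; rewrite inE => /predU1P[->|ys j].
    by move=> /(joins_inj jx)[] [<- <-]; rewrite !inE !eqxx ?orbT.
  by have /andP[ap bp] := sends y a b ys j; rewrite !(in_cons u) ap bp !orbT.
move=> y0 [|i] //= ip; have := sj y0 i ip.
by rewrite /= !(set_nth_default v u) //= ltnW.
Qed.

(** A simple path in the rest of [T] between the ends of [x] would form a cycle with [x]. *)
Lemma acyclic_disconnect T x :
  acyclic T -> x \in T ->
  ~~ connect (adjacent (T :\ x)) (inl (endV x)) (inr (endE x)).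
Proof.
move=> acT xT; apply/negP => /connectP[p0 pth0 last0].
move: pth0 last0; case/shortenP => p pth up _ {p0} last_p.
set u := inl _ in pth up last_p.
have [s [sz sT us _ sj]] := path_edges pth up.
have xs : x \notin s by apply/negP => /sT; rewrite !inE eqxx.
have p0 : (0 < size p)%N by case: (p) last_p.
pose w := last u p.
have jx : joins x w u by rewrite /w -last_p joins_sym; apply: joins_ends.
(* The cycle starts with [x], traversed from the last vertex [w] back to [u]; hence the vertices of
   the path are rotated by one. *)
pose q := w :: belast u p.
have uc : uniq (x :: s) by rewrite /= xs.
have sq : size q == size (x :: s) by rewrite /= size_belast sz.
have cyc : is_cycle (x :: s).
  apply/and3P; split=> //; apply/existsP; exists (Tuple sq); apply/andP; split.
    by rewrite -(rot_uniq 1) /q /= rot1_cons -lastI.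
  apply/forallP => -[[|i] lti].
    rewrite !(tnth_nth x) !(tnth_nth u) /= sz modn_small //.
    by move: jx; rewrite /q /w; case: (p) p0.
  have ip : (i < size p)%N by rewrite -sz.
  rewrite !(tnth_nth x) !(tnth_nth u) /= sz.
  have := sj x i ip; rewrite [u :: p]lastI nth_rcons size_belast ip.
  suff -> : nth u q (i.+2 %% (size p).+1) = nth u p i by [].
  have [lt|] := boolP (i.+1 < size p)%N.
    rewrite modn_small //= -[nth u p i]/(nth u (u :: p) i.+1).
    by rewrite lastI nth_rcons size_belast lt.
  rewrite -leqNgt => ge; have -> : i = (size p).-1 by move: ip ge; clear; lia.
  by rewrite prednK // modnn /= nth_last.
have le_c : (size (x :: s) < #|edge G|.+1)%N.
  by rewrite ltnS -(card_uniqP uc) max_card.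
have /forallP/(_ (Ordinal le_c))/forallP/(_ (in_tuple (x :: s)))/implyP := acT.
rewrite /= cyc /=; move/(_ _)/negP; apply=> //.
by rewrite xT; apply/allP => y /sT; rewrite inE => /andP[].
Qed.

Definition spans A Y : bool :=
  [forall x in A, (inl (endV x) \in Y) && (inr (endE x) \in Y)].

Lemma spansP A Y :
  reflect {in A, forall x, (inl (endV x) \in Y) /\ (inr (endE x) \in Y)} (spans A Y).
Proof.
by apply: (iffP forall_inP) => H x xA; apply/andP; [exact: H | have [-> ->] := H x xA].
Qed.

(** Removing an edge [x] separates its ends, so the other edges fall into two forests on disjoint
    nonempty parts of Y. By induction each part has at least one vertex more than edges, and [x]
    uses up one of these two. *)
Lemma forest_bound T Y : acyclic T -> Y != set0 -> spans T Y -> (#|T| < #|Y|)%N.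
Proof.
elim: {T}_.+1 {-2}T (ltnSn #|T|) Y => // k IH T le_k Y acT Y0 /spansP TY.
have [->|] := eqVneq T set0; first by rewrite cards0 card_gt0.
case/set0Pn => x xT; have := acyclic_disconnect acT xT.
set u := inl (endV x) => ncx.
have sat := connect_saturated (T :\ x) u.
pose Z := [set v | connect (adjacent (T :\ x)) u v].
pose T1 := [set y in T :\ x | inl (endV y) \in Z].
pose T2 := [set y in T :\ x | inl (endV y) \notin Z].
have T1T : T1 \subset T :\ x by apply/subsetP => y; rewrite inE => /andP[].
have T2T : T2 \subset T :\ x by apply/subsetP => y; rewrite inE => /andP[].
have cT : #|T| = (#|T1| + #|T2|).+1.
  rewrite (cardsD1 x T) xT add1n; congr _.+1.
  rewrite -(cardsID [set y | inl (endV y) \in Z] (T :\ x)); congr (_ + _)%N.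
    by apply: eq_card => y; rewrite !inE.
  by apply: eq_card => y; rewrite !inE andbC.
have subT B : B \subset T :\ x -> acyclic B.
  by move=> sB; apply: acyclicS acT; apply: subset_trans sB (subD1set _ _).
have [uY xY] := TY x xT.
have b1 : (#|T1| < #|Y :&: Z|)%N.
  apply: IH; [by move: le_k; rewrite cT; clear; lia|exact: subT| |].
    by apply/set0Pn; exists u; rewrite !inE uY connect0.
  apply/spansP => y; rewrite inE => /andP[yT yZ].
  have [yV yE] := TY y (subsetP (subD1set _ _) y yT).
  by rewrite !(in_setI, yV, yE) -(saturatedP _ _ sat) ?yZ.
have b2 : (#|T2| < #|Y :\: Z|)%N.
  apply: IH; [by move: le_k; rewrite cT; clear; lia|exact: subT| |].
    by apply/set0Pn; exists (inr (endE x)); rewrite in_setD xY inE ncx.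
  apply/spansP => y; rewrite inE => /andP[yT yZ].
  have [yV yE] := TY y (subsetP (subD1set _ _) y yT).
  by rewrite !(in_setD, yV, yE) -(saturatedP _ _ sat) ?yZ.
by move: b1 b2; rewrite -(cardsID Z Y) cT; clear; lia.
Qed.

Definition connects T W : bool :=
  [forall u in W, forall v in W, connect (adjacent T) u v].

Lemma connectsP T W :
  reflect {in W &, forall u v, connect (adjacent T) u v} (connects T W).
Proof.
apply: (iffP forall_inP) => H u; first by move=> v uW; move/forall_inP: (H u uW); apply.
by move=> uW; apply/forall_inP => v; apply: H.
Qed.

(** A largest vertex set Y around [u] with at most one vertex more than inner edges is all of [W]:
    otherwise an edge leaves Y, and adding its other end gains an inner edge as well. *)
Lemma connected_bound T W : spans T W -> connects T W -> (#|W| <= #|T|.+1)%N.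
Proof.
move=> /spansP TW /connectsP cW.
have [->|/set0Pn[u uW]] := eqVneq W set0; first by rewrite cards0.
pose inner Y := [set x in T | (inl (endV x) \in Y) && (inr (endE x) \in Y)].
pose P Y := [&& u \in Y, Y \subset W & (#|Y| <= #|inner Y|.+1)%N].
have P0 : P [set u] by rewrite /P set11 sub1set uW cards1.
case: (@arg_maxnP _ _ P (fun Y => #|Y|) P0) => Y /and3P[uY YW le_Y] maxY.
have [sat|] := boolP (saturated T Y).
  suff <- : Y = W.
    apply: leq_trans le_Y _; rewrite ltnS; apply: subset_leq_card.
    by apply/subsetP => x; rewrite inE => /andP[].
  apply/eqP; rewrite eqEsubset YW; apply/subsetP => v vW.
  by rewrite -(saturated_connect sat (cW u v uW vW)).
rewrite negb_forall_in => /exists_inP[x xT ne].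
have [w [wY wW xin]] : exists w, [/\ w \notin Y, w \in W & x \in inner (w |: Y)].
  have [xV xE] := TW x xT; move: ne.
  case: (boolP (inl _ \in Y)) => v1; case: (boolP (inr _ \in Y)) => v2 // _.
    by exists (inr (endE x)); rewrite v2 xE !inE xT v1 eqxx orbT.
  by exists (inl (endV x)); rewrite v1 xV !inE xT v2 eqxx orbT.
have : (#|w |: Y| <= #|Y|)%N.
  apply: maxY; rewrite /P inE uY orbT subUset sub1set wW YW cardsU1 wY /=.
  rewrite ltnS; apply: leq_trans le_Y _.
  have xY : x \notin inner Y.
    by move: ne; rewrite inE xT /=; case: (_ \in Y) (_ \in Y) => -[].
  rewrite -[X in (X <= _)%N]add1n -[1%N]/(true : nat) -xY -cardsU1.
  apply/subset_leq_card; rewrite subUset sub1set xin /=.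
  by apply/subsetP => y; rewrite !inE => /and3P[-> -> ->]; rewrite !orbT.
by rewrite cardsU1 wY ltnn.
Qed.

(** The rest of the cycle bypasses its first edge. *)
Lemma cycle_connect T c : all (mem T) c -> is_cycle c ->
  exists2 x, x \in T & connect (adjacent (T :\ x)) (inl (endV x)) (inr (endE x)).
Proof.
case: c => [|x s] //= /andP[xT /allP sT0] /and3P[_ /= /andP[xs _]].
case/existsP => p /andP[_ /forallP Hp]; exists x => //.
have sT y : y \in s -> y \in T by move/sT0.
set u := inl (endV x).
have Hi i : (i < (size s).+1)%N ->
    joins (nth x (x :: s) i) (nth u p i) (nth u p (i.+1 %% (size s).+1)).
  by move=> lti; have := Hp (Ordinal lti); rewrite !(tnth_nth x) !(tnth_nth u).
have conn i : (i.+1 < (size s).+1)%N ->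
    connect (adjacent (T :\ x)) (nth u p 1) (nth u p i.+1).
  elim: i => [|i IH] lti; first exact: connect0.
  apply: connect_trans (IH (ltnW lti)) _; apply: connect1.
  apply/adjacentP; exists (nth x s i).
    have ms : nth x s i \in s by rewrite mem_nth // -ltnS ltnW.
    by rewrite !inE (sT _ ms) andbT; apply: contraNneq xs => <-.
  by have := Hi i.+1 (ltnW lti); rewrite modn_small.
have s0 : (0 < size s)%N.
  rewrite lt0n; apply/eqP => s0; have := joins_neq (Hi 0%N isT).
  have e0 : (1 %% (size s).+1 = 0)%N by rewrite s0.
  by rewrite e0 eqxx.
have j0 := Hi 0%N isT; rewrite modn_small //= in j0.
have c10 : connect (adjacent (T :\ x)) (nth u p 1) (nth u p 0).
  have := conn (size s).-1; rewrite prednK // => /(_ (ltnSn _)).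
  move/connect_trans; apply; apply: connect1; apply/adjacentP.
  exists (nth x s (size s).-1).
    have ms : nth x s (size s).-1 \in s by rewrite mem_nth // prednK.
    by rewrite !inE (sT _ ms) andbT; apply: contraNneq xs => <-.
  by have := Hi (size s) (ltnSn _); rewrite modnn -{1}(prednK s0).
case: (joins_inj j0 (joins_ends x)) => -[e0 e1]; rewrite e0 e1 in c10 => //.
by rewrite connect_adjacent_sym.
Qed.

Lemma connectD1 T x u v :
  connect (adjacent (T :\ x)) (inl (endV x)) (inr (endE x)) ->
  connect (adjacent T) u v -> connect (adjacent (T :\ x)) u v.
Proof.
move=> cx; apply: connect_sub => {u v} u v /adjacentP[y yT jy].
have [yx|yx] := eqVneq y x; last first.
  by apply/connect1/adjacentP; exists y; rewrite // !inE yx.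
rewrite yx in jy; case: (joins_inj jy (joins_ends x)) => -[-> ->] //.
by rewrite connect_adjacent_sym.
Qed.

(** An edge on a cycle could be removed without losing connectedness, leaving too few edges for
    [connected_bound]. *)
Lemma acyclic_card T W :
  spans T W -> connects T W -> (#|T| < #|W|)%N -> acyclic T.
Proof.
move=> /spansP TW /connectsP cW lt; apply/forallP => m; apply/forallP => c.
apply/implyP => cT; apply/negP => cyc.
have [x xT cx] := cycle_connect cT cyc.
have : (#|W| <= #|T :\ x|.+1)%N.
  apply: connected_bound; first by apply/spansP => y /(subsetP (subD1set _ _))/TW.
  by apply/connectsP => u v uW vW; apply: connectD1 => //; apply: cW.
by move: lt; rewrite (cardsD1 x T) xT; clear; lia.
Qed.

End Forests.

Section Sides.
Variable G : bigraph.
Implicit Types (A T : {set edge G}) (W : {set vertex G}).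

Definition sideV W : {set classV G} := [set v | inl v \in W].
Definition sideE W : {set classE G} := [set e | inr e \in W].

Lemma card_sides W : #|W| = (#|sideV W| + #|sideE W|)%N.
Proof.
rewrite -!sum1_card big_sumType /=.
by congr (_ + _)%N; apply: eq_bigl => a; rewrite inE.
Qed.

Lemma nbr_pairsP A (X : {set classE G}) v :
  reflect (exists x, [/\ x \in A, endE x \in X & v = endV x]) (v \in nbr (pairs A) X).
Proof.
apply: (iffP (nbrP _ _ _)) => [[e eX /imsetP[x xA [-> ee]]]|[x [xA eX ->]]].
  by exists x; rewrite -ee.
by exists (endE x) => //; apply: imset_f.
Qed.

Lemma sum_degE T (X : {set classE G}) :
  (\sum_(e in X) degE T e = #|[set x in T | endE x \in X]|)%N.
Proof.
rewrite -sum1dep_card (partition_big (fun x => endE x) (mem X)) /=; last first.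
  by move=> x /andP[].
apply: eq_bigr => e eX; rewrite /degE -sum1dep_card; apply: eq_bigl => x.
by case: eqVneq => [->|]; rewrite ?eX ?andbT ?andbF.
Qed.

End Sides.

(** * Hypertrees of a connected graph are the bases *)

Section Hypertrees.
Variables (G : bigraph) (W : {set vertex G}) (B : {set edge G}).
Hypotheses (BW : spans B W) (cW : connects B W) (W1 : (1 < #|W|)%N).
Let Q := sideE W.
Let R := pairs B.
Implicit Types (X : {set classE G}) (T : {set edge G}) (f : classE G -> nat).

Lemma saturated_full Z u v :
  saturated B Z -> u \in W -> v \in W -> u \in Z -> v \in Z.
Proof.
by move=> sat uW vW uZ; rewrite -(saturated_connect sat (connectsP _ _ cW u v uW vW)).
Qed.

Lemma incident u : u \in W ->
  exists2 x, x \in B & (inl (endV x) == u) || (inr (endE x) == u).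
Proof.
move=> uW; have [sat|] := boolP (saturated B [set u]).
  have sWu : W \subset [set u].
    apply/subsetP => v vW; have := saturated_full sat uW vW.
    by rewrite inE eqxx; apply.
  by have := subset_leq_card sWu; rewrite cards1 leqNgt W1.
rewrite negb_forall_in => /exists_inP[x xB]; rewrite !inE => ne; exists x => //.
by move: ne; do 2 case: (_ == u).
Qed.

Lemma nbr_sides : nbr R Q = sideV W.
Proof.
apply/setP => v; rewrite inE; apply/nbr_pairsP/idP => [[x [xB _ ->]]|vW].
  by have [] := spansP _ _ BW x xB.
have [x xB /orP[/eqP[xv]|//]] := incident vW.
by exists x; split; rewrite // inE; have [] := spansP _ _ BW x xB.
Qed.

Lemma nbr_neq0 e : e \in Q -> nbr R [set e] != set0.
Proof.
rewrite inE => eW; have [x xB /orP[//|/eqP[xe]]] := incident eW.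
by apply/set0Pn; exists (endV x); apply/nbr_pairsP; exists x; rewrite inE xe.
Qed.

Lemma sideE_neq0 : Q != set0.
Proof.
apply: contraTneq W1 => Q0; rewrite card_sides -/Q -nbr_sides Q0 cards0 addn0.
rewrite (_ : nbr R set0 = set0) ?cards0 //.
by apply/setP => v; rewrite inE; apply/nbr_pairsP => -[x []]; rewrite inE.
Qed.

(** Otherwise X together with its neighbours would be saturated, although it meets the connected set
    [W] without containing it. *)
Lemma nbr_connected X : X != set0 -> X \proper Q ->
  exists2 e, e \in Q :\: X & ~~ [disjoint nbr R [set e] & nbr R X].
Proof.
case/set0Pn => e0 e0X /properP[XQ [e1 e1Q e1X]].
apply/exists_inP; apply: contraT; rewrite negb_exists_in => /forall_inP dis.
pose Z : {set vertex G} := [set inr e | e in X] :|: [set inl v | v in nbr R X].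
have memZ : (forall e, (inr e \in Z) = (e \in X)) *
            (forall v, (inl v \in Z) = (v \in nbr R X)).
  split=> a; rewrite inE.
    rewrite mem_imset; last by move=> ? ? [].
    by rewrite orbC; case: imsetP => // -[].
  rewrite [X in _ || X]mem_imset; last by move=> ? ? [].
  by case: imsetP => // -[].
have sat : saturated B Z.
  apply/saturatedP => x xB; rewrite !memZ; apply/idP/idP => xX; last first.
    by apply/nbr_pairsP; exists x.
  apply: contraT => eX; have [_ xQ] := spansP _ _ BW x xB.
  have /dis : endE x \in Q :\: X by rewrite !inE eX.
  rewrite negbK => /pred0P/(_ (endV x)) /=; rewrite xX andbT.
  by move/negP; case; apply/nbr_pairsP; exists x; rewrite inE.
rewrite /Q !inE in e1Q; have e0W : inr e0 \in W by have := subsetP XQ _ e0X; rewrite inE.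
by have := saturated_full sat e0W e1Q; rewrite !memZ e0X (negPf e1X) => /(_ isT).
Qed.

(** The tree edges at X form a forest on X and N(X), which gives the strict inequality; for X = Q,
    connectedness of the tree gives the reverse bound. *)
Lemma hypertree_base f : hypertree W B f -> base R Q f.
Proof.
case/andP => /forallP f0 /existsP[T /andP[/and3P[TB acT cT] /forallP degT]].
have TW : spans T W by apply/spansP => x /(subsetP TB); apply: spansP.
have sumf X : X \subset Q ->
    (\sum_(e in X) f e + #|X| = #|[set x in T | endE x \in X]|)%N.
  move=> XQ; rewrite -sum_degE -sum1_card -big_split /=; apply: eq_bigr => e eX.
  have := subsetP XQ e eX; rewrite inE => eW.
  by have /implyP/(_ eW)/eqP -> := degT e; rewrite addn1.
have bound X : X != set0 -> X \subset Q -> (\sum_(e in X) f e < #|nbr R X|)%N.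
  case/set0Pn => e0 e0X XQ.
  pose Y : {set vertex G} := [set inr e | e in X] :|: [set inl v | v in nbr R X].
  have : (#|[set x in T | endE x \in X]| < #|Y|)%N.
    apply: forest_bound.
    - by apply: acyclicS acT; apply/subsetP => x; rewrite inE => /andP[].
    - by apply/set0Pn; exists (inr e0); rewrite inE imset_f.
    apply/spansP => x; rewrite inE => /andP[xT xX]; rewrite !inE !imset_f ?orbT //.
    by apply/nbr_pairsP; exists x; rewrite (subsetP TB).
  have leY : (#|Y| <= #|X| + #|nbr R X|)%N.
    apply: leq_trans (leq_card_setU _ _).1 _.
    by apply: leq_add; apply: leq_imset_card.
  by move: leY; rewrite -sumf //; clear; lia.
apply/baseP; split; [|exact/draconianP|].
  by move=> e eQ; apply/eqP; have /implyP := f0 e; apply; rewrite inE in eQ.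
apply/eqP; rewrite eqn_leq bound ?sideE_neq0 // nbr_sides.
have := connected_bound TW cT; rewrite card_sides -/Q.
have -> : #|T| = (\sum_(e in Q) f e + #|Q|)%N.
  rewrite sumf //; apply: eq_card => x; rewrite !inE.
  by case xT: (x \in T) => //; have [_ ->] := spansP _ _ TW x xT.
by clear; lia.
Qed.

(* Each edge of a minimal [T] at [e] is needed by some tight set containing
   [e]; the intersection of all of these is tight and needs all the edges. *)
Lemma minimal_degE f T e :
  draconian (pairs T) Q f ->
  {in T, forall x, ~~ draconian (pairs (T :\ x)) Q f} -> e \in Q ->
  degE T e = (f e).+1.
Proof.
move=> DT minT eQ.
have tightx x : x \in T -> endE x = e ->
    exists X, [/\ tight (pairs T) Q f X, e \in X & endV x \notin nbr (pairs (T :\ x)) X].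
  move=> xT xe; have [X [X0 XQ leX]] := draconianPn (minT x xT).
  have DX : (\sum_(a in X) f a < #|nbr (pairs T) X|)%N by have /draconianP := DT; apply.
  have subX : nbr (pairs T) X \subset endV x |: nbr (pairs (T :\ x)) X.
    apply/subsetP => v /nbr_pairsP[y [yT yX ->]]; rewrite in_setU1.
    have [->|yx] := eqVneq y x; first by rewrite eqxx.
    by apply/orP; right; apply/nbr_pairsP; exists y; rewrite !inE yx.
  have := subset_leq_card subX; rewrite cardsU1.
  exists X; split.
  - apply/and3P; split=> //; move: H DX leX; case: (_ \notin _); clear; lia.
  - apply: contraLR DX => eX; rewrite -leqNgt; apply: leq_trans leX.
    apply/subset_leq_card/subsetP => v /nbr_pairsP[y [yT yX ->]].
    apply/nbr_pairsP; exists y; split=> //; rewrite !inE yT andbT.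
    by apply: contraNneq eX => yx; rewrite -xe -yx.
  - by move: H DX leX; case: (_ \notin _) => //; clear; lia.
have D1 : (f e < #|nbr (pairs T) [set e]|)%N.
  have /draconianP/(_ [set e]) := DT; rewrite big_set1; apply; rewrite ?sub1set //.
  by apply/set0Pn; exists e; rewrite inE.
have eq1 : nbr (pairs T) [set e] = [set endV x | x in [set x in T | endE x == e]].
  apply/setP => v; apply/nbr_pairsP/imsetP => [[x [xT]]|[x]].
    by rewrite inE => xe ->; exists x; rewrite // inE xT.
  by rewrite inE => /andP[xT xe ->]; exists x; rewrite inE.
have [x0 x0T x0e] : exists2 x, x \in T & endE x = e.
  have : (0 < #|nbr (pairs T) [set e]|)%N by apply: leq_trans D1.
  by case/card_gt0P => v /nbr_pairsP[x [xT]]; rewrite inE => /eqP; exists x.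
have [X0 [tX0 eX0 _]] := tightx x0 x0T x0e.
pose P X := tight (pairs T) Q f X && (e \in X).
have PX0 : P X0 by rewrite /P tX0.
case: (@arg_minnP _ _ P (fun X => #|X|) PX0) => X /andP[tX eX] minX.
(* Being smallest, [X] lies in the tight set that needs [x]; so no other edge of [T] joins [X] to
   [endV x]. *)
have priv x : x \in T -> endE x = e -> endV x \notin nbr (pairs (T :\ x)) X.
  move=> xT xe; have [Y [tY eY]] := tightx x xT xe; apply: contra.
  apply: subsetP; apply: nbrS => //; apply/setIidPl/eqP.
  rewrite eqEcard subsetIl minX // /P inE eX eY !andbT; apply: tightI => //.
  by apply/set0Pn; exists e; rewrite inE eX.
have card1 : #|nbr (pairs T) [set e]| = degE T e.
  rewrite eq1 card_in_imset // => x y; rewrite !inE.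
  move=> /andP[xT /eqP xe] /andP[yT /eqP ye] exy.
  have := priv x xT xe; have [//|ne] := eqVneq x y; case/nbr_pairsP.
  by exists y; rewrite !inE eq_sym ne ye.
have dis : [disjoint nbr (pairs T) (X :\ e) & nbr (pairs T) [set e]].
  rewrite eq1; apply/pred0P => v /=; apply/negP => /andP[/nbr_pairsP[y [yT yX ->]]].
  case/imsetP => x; rewrite inE => /andP[xT /eqP xe] exy.
  have := priv x xT xe; case/nbr_pairsP.
  move: yX; rewrite in_setD1 => /andP[ye yX]; exists y; split=> //.
  by rewrite !inE yT andbT; apply: contraNneq ye => ->; rewrite xe.
have [_ XQ /eqP cX] := and3P tX.
have : #|nbr (pairs T) X| = (#|nbr (pairs T) (X :\ e)| + degE T e)%N.
  have {1}-> : X = (X :\ e) :|: [set e] by rewrite setUC setD1K.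
  rewrite nbrU cardsU disjoint_setI0 // cards0 subn0 card1 //.
rewrite cX (big_setD1 e) //=; rewrite card1 in D1.
(* If [X] had further elements, their strict inequality would give [degE T e <= f e], against [D1].
   So [X] consists of [e] alone, and its tightness is the claim. *)
have [X1|X1] := eqVneq (X :\ e) set0.
  rewrite X1 big_set0 (_ : nbr (pairs T) set0 = set0) ?cards0; first by clear; lia.
  by apply/setP => v; rewrite inE; apply/nbr_pairsP => -[x []]; rewrite inE.
have /draconianP/(_ _ X1 (subset_trans (subD1set _ _) XQ)) := DT.
by move: D1; clear; lia.
Qed.

(** A smallest edge set [T] for which [f] is still draconian has the right degrees, hence |W| - 1
    edges. If it were disconnected, adding the strict inequalities of two parts would make the sum
    of [f] too small; being connected with so few edges, it is acyclic. *)
Lemma base_hypertree f : base R Q f -> hypertree W B f.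
Proof.
move=> /baseP[f0 Df tf].
pose P (T : {set edge G}) := (T \subset B) && draconian (pairs T) Q f.
have PB : P B by rewrite /P subxx.
case: (@arg_minnP _ _ P (fun T => #|T|) PB) => T /andP[TB DT] minT.
have degT e : e \in Q -> degE T e = (f e).+1.
  apply: minimal_degE => // x xT; apply/negP => DTx.
  have : (#|T| <= #|T :\ x|)%N.
    by apply: minT; rewrite /P DTx andbT (subset_trans (subD1set _ _)).
  by rewrite (cardsD1 x T) xT add1n ltnn.
have TW : spans T W by apply/spansP => x /(subsetP TB); apply: spansP.
have cardT : (#|T|.+1 = #|W|)%N.
  rewrite card_sides -/Q -nbr_sides -tf addSn; congr _.+1.
  transitivity (\sum_(e in Q) degE T e)%N.
    rewrite sum_degE; apply: eq_card => x; rewrite !inE.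
    by case xT: (x \in T) => //; have [_ ->] := spansP _ _ TW x xT.
  rewrite -[#|Q|]sum1_card -big_split /=.
  by apply: eq_bigr => e /degT ->; rewrite addn1.
(* A part without elements of E is covered too: it is then a nonempty set of elements of V, and the
   sum is 0. *)
have part Z : saturated T Z -> W :&: Z != set0 ->
    (\sum_(e in sideE (W :&: Z)) f e < #|sideV (W :&: Z)|)%N.
  move=> /saturatedP sat WZ.
  have [E0|En0] := eqVneq (sideE (W :&: Z)) set0.
    have := card_sides (W :&: Z); rewrite E0 big_set0 cards0 addn0 => <-.
    by rewrite card_gt0.
  have EQ : sideE (W :&: Z) \subset Q.
    by apply/subsetP => e; rewrite !inE => /andP[].
  have /draconianP/(_ _ En0 EQ) := DT; move/leq_trans; apply.
  apply/subset_leq_card/subsetP => v /nbr_pairsP[x [xT]]; rewrite !inE => /andP[xW xZ] ->.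
  by rewrite sat // xZ; have [-> _] := spansP _ _ TW x xT.
have cT : connects T W.
  apply/connectsP => u v uW vW; apply: contraT => nuv.
  pose Z := [set w | connect (adjacent T) u w].
  have satZ : saturated T Z by apply: connect_saturated.
  have satC : saturated T (~: Z).
    by apply/saturatedP => x xT; rewrite !in_setC (saturatedP _ _ satZ).
  have p1 := part Z satZ; have p2 := part _ satC.
  have /p1{}p1 : W :&: Z != set0 by apply/set0Pn; exists u; rewrite !inE uW connect0.
  have /p2{}p2 : W :&: ~: Z != set0 by apply/set0Pn; exists v; rewrite !inE vW nuv.
  have cV : (#|sideV (W :&: Z)| + #|sideV (W :&: ~: Z)| = #|sideV W|)%N.
    rewrite -(cardsID (sideV Z) (sideV W)).
    by congr (_ + _)%N; apply: eq_card => a; rewrite !inE // andbC.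
  have sE : (\sum_(e in sideE (W :&: Z)) f e + \sum_(e in sideE (W :&: ~: Z)) f e
             = \sum_(e in Q) f e)%N.
    rewrite [RHS](big_setID (sideE Z)) /=.
    by congr (_ + _)%N; apply: eq_bigl => a; rewrite !inE // andbC.
  rewrite nbr_sides in tf; move: p1 p2 cV sE tf; clear; lia.
have acT : acyclic T by apply: acyclic_card TW cT _; rewrite -cardT.
apply/andP; split.
  by apply/forallP => e; apply/implyP => eW; rewrite f0 // inE.
apply/existsP; exists T; apply/andP; split; first exact/and3P.
by apply/forallP => e; apply/implyP => eW; rewrite degT // inE.
Qed.

Lemma hypertreeE f : hypertree W B f = base R Q f.
Proof. by apply/idP/idP => [/hypertree_base|/base_hypertree]. Qed.

End Hypertrees.

(** * The interior polynomial as a sum over degree vectors *)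

Section DegreeSeries.
Variable G : bigraph.
Implicit Types (A : {set edge G}) (W C : {set vertex G}) (h : classE G -> nat).
Implicit Types (X : {set classE G}).

Definition supported W h : bool := [forall e, (e \notin sideE W) ==> (h e == 0%N)].

Lemma supportedP W h :
  reflect (forall e, e \notin sideE W -> h e = 0%N) (supported W h).
Proof.
apply: (iffP forallP) => H e; first by move=> eW; have := H e; rewrite eW => /eqP.
by apply/implyP => /H ->.
Qed.

Lemma nbr_saturated A W X :
  saturated A W -> X \subset sideE W -> nbr (pairs A) X \subset sideV W.
Proof.
move=> /saturatedP sat XW; apply/subsetP => v /nbr_pairsP[x [xA xX ->]].
by have := subsetP XW _ xX; rewrite !inE sat.
Qed.

(** Ensures that the exponent in [weight] is a true difference. *)
Lemma degrees_bound A W h :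
  saturated A W -> supported W h -> degrees (pairs A) h -> (\sum_e h e <= #|W|)%N.
Proof.
move=> sat sh /draconianP D; set X := [set e | (0 < h e)%N] in D.
have XW : X \subset sideE W.
  apply/subsetP => e; apply: contraLR => /(supportedP _ _ sh) he.
  by rewrite inE he.
have -> : (\sum_e h e = \sum_(e in X) (h e).-1 + #|X|)%N.
  rewrite -[#|X|]sum1_card -big_split /= [RHS]big_mkcond; apply: eq_bigr => e _.
  by rewrite inE; case: (h e) => //= k; rewrite addn1.
have [->|X0] := eqVneq X set0; first by rewrite big_set0 cards0.
have := D X X0 (subxx _); have := subset_leq_card XW.
have := subset_leq_card (nbr_saturated sat XW); rewrite (card_sides W); clear; lia.
Qed.

Lemma degreesS A h h1 :
  (forall e, h1 e = h e \/ h1 e = 0%N) -> degrees (pairs A) h -> degrees (pairs A) h1.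
Proof.
move=> hh /draconianP D; apply/draconianP => X X0 sX.
have eqh e : e \in X -> h1 e = h e.
  by move=> /(subsetP sX); rewrite inE; case: (hh e) => ->.
rewrite (eq_bigr (fun e => (h e).-1)) => [|e /eqh -> //]; apply: D => //.
by apply/subsetP => e eX; rewrite inE -eqh //; have := subsetP sX e eX; rewrite inE.
Qed.

(** A set X splits into its parts in [W1] and [W2], whose neighbourhoods are disjoint by saturation,
    so the inequalities add up. *)
Lemma degrees_add A W1 W2 h h1 h2 :
  saturated A W1 -> saturated A W2 -> [disjoint W1 & W2] ->
  supported W1 h1 -> supported W2 h2 -> (forall e, h e = h1 e + h2 e)%N ->
  degrees (pairs A) h1 -> degrees (pairs A) h2 -> degrees (pairs A) h.
Proof.
move=> sat1 sat2 dis /supportedP s1 /supportedP s2 hE /draconianP D1 /draconianP D2.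
have disE e : e \in sideE W1 -> e \in sideE W2 -> False.
  by rewrite !inE => e1 e2; have /pred0P/(_ (inr e)) := dis; rewrite /= e1 e2.
apply/draconianP => X X0 sX.
pose X1 := X :&: sideE W1; pose X2 := X :\: sideE W1.
have h1E e : e \in X1 -> h e = h1 e.
  rewrite inE => /andP[_ eW]; rewrite hE s2 ?addn0 //.
  by apply/negP; apply: disE.
have h2E e : e \in X2 -> h e = h2 e.
  by rewrite inE => /andP[eW _]; rewrite hE s1.
have pos e : e \in X -> (0 < h e)%N by move/(subsetP sX); rewrite inE.
have sX1 : X1 \subset [set e | (0 < h1 e)%N].
  by apply/subsetP => e e1; rewrite inE -h1E // pos //; move: e1; rewrite inE => /andP[].
have sX2 : X2 \subset [set e | (0 < h2 e)%N].
  by apply/subsetP => e e2; rewrite inE -h2E // pos //; move: e2; rewrite inE => /andP[].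
have W2X : X2 \subset sideE W2.
  by apply/subsetP => e /(subsetP sX2); rewrite inE; apply: contraLR => /s2 ->.
have cX : #|nbr (pairs A) X| = (#|nbr (pairs A) X1| + #|nbr (pairs A) X2|)%N.
  have disN : [disjoint nbr (pairs A) X1 & nbr (pairs A) X2].
    apply: disjointWl (nbr_saturated sat1 (subsetIr X (sideE W1))) _.
    apply: disjointWr (nbr_saturated sat2 W2X) _.
    by apply/pred0P => v; rewrite /= !inE; have /pred0P/(_ (inl v)) := dis.
  have {1}-> : X = X1 :|: X2 by rewrite setID.
  by rewrite nbrU cardsU (disjoint_setI0 disN) cards0 subn0.
have e1 : (\sum_(e in X1) (h e).-1 = \sum_(e in X1) (h1 e).-1)%N.
  by apply: eq_bigr => e /h1E ->.
have e2 : (\sum_(e in X2) (h e).-1 = \sum_(e in X2) (h2 e).-1)%N.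
  by apply: eq_bigr => e /h2E ->.
rewrite cX (big_setID (sideE W1)) /= -/X1 -/X2 e1 e2.
have [X10|X10] := eqVneq X1 set0; have [X20|X20] := eqVneq X2 set0.
- by move: X0; rewrite -(setID X (sideE W1)) -/X1 -/X2 X10 X20 setU0 eqxx.
- by rewrite X10 big_set0 ltn_addl // D2.
- by rewrite X20 big_set0 addn0 ltn_addr // D1.
- by have := D1 _ X10 sX1; have := D2 _ X20 sX2; clear; lia.
Qed.

Local Notation degfun := {ffun classE G -> 'I_#|edge G|.+1}.

(** The exponent of 1 - x is |W| - |h|, one more than in the formula for I'. With this choice the
    empty set has series 1 and disjoint saturated sets multiply. *)
Definition degree_series A W : {poly int} :=
  \sum_(h : degfun |
        supported W (fun e => h e) && degrees (pairs A) (fun e => h e))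
    weight #|W| (fun e => h e).

Lemma degree_series0 A : degree_series A set0 = 1.
Proof.
rewrite /degree_series (big_pred1 [ffun=> ord0]).
  rewrite /weight cards0 sub0n mulr1 (_ : [set _ | _] = set0) ?cards0 //.
  by apply/setP => e; rewrite !inE ffunE.
move=> h; apply/andP/eqP => [[/supportedP H _]|->].
  by apply/ffunP => e; rewrite ffunE; apply: val_inj; rewrite /= H // !inE.
split; first by apply/supportedP => e _; rewrite ffunE.
apply/draconianP => X /set0Pn[e eX] /subsetP/(_ e eX).
by rewrite inE ffunE.
Qed.

Lemma weightD (a1 a2 : nat) h h1 h2 :
  (forall e, h e = h1 e + h2 e)%N -> (forall e, h1 e = 0%N \/ h2 e = 0%N) ->
  (\sum_e h1 e <= a1)%N -> (\sum_e h2 e <= a2)%N ->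
  weight (a1 + a2) h = weight a1 h1 * weight a2 h2.
Proof.
move=> hE h0 le1 le2; rewrite /weight mulrACA -!exprD; congr ('X^_ * _ ^+ _).
  have cE k : #|[set e : classE G | (0 < k e)%N]| = (\sum_e (0 < k e)%N)%N.
    by rewrite -sum1dep_card big_mkcond; apply: eq_bigr => e _; case: ifP.
  rewrite !cE -big_split /=; apply: eq_bigr => e _.
  by rewrite hE; case: (h0 e) => ->; rewrite ?addn0.
rewrite (eq_bigr _ (fun e _ => hE e)) big_split /=.
by move: le1 le2; clear; lia.
Qed.

(** A vector on the union amounts to a pair of vectors on the two parts: [mrg] glues them and [res]
    restricts. *)
Lemma degree_seriesU A W1 W2 :
  saturated A W1 -> saturated A W2 -> [disjoint W1 & W2] ->
  degree_series A (W1 :|: W2) = degree_series A W1 * degree_series A W2.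
Proof.
move=> sat1 sat2 dis; rewrite [RHS]big_distrlr pair_big /=.
pose mrg (p : degfun * degfun) : degfun :=
  [ffun e => if e \in sideE W1 then p.1 e else p.2 e].
pose res W (h : degfun) : degfun :=
  [ffun e => if e \in sideE W then h e else ord0].
have disE e : e \in sideE W1 -> e \in sideE W2 = false.
  move=> e1; apply/negP; rewrite !inE in e1 *.
  by move=> e2; have /pred0P/(_ (inr e)) := dis; rewrite /= e1 e2.
rewrite /degree_series (reindex_onto mrg (fun g => (res W1 g, res W2 g))) /=; last first.
  move=> h /andP[/supportedP sh _]; apply/ffunP => e; rewrite !ffunE /=.
  have [//|e1] := boolP (e \in sideE W1); have [//|e2] := boolP (e \in sideE W2).
  apply: val_inj => /=; rewrite sh //.
  by rewrite !inE in e1 e2; rewrite !inE negb_or e1.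
have mrgE (p : degfun * degfun) :
    supported W1 (fun e => p.1 e) -> supported W2 (fun e => p.2 e) ->
    forall e, (mrg p e = p.1 e + p.2 e :> nat)%N.
  move=> /supportedP s1 /supportedP s2 e; rewrite ffunE; case: ifPn => e1.
    by rewrite s2 ?addn0 // disE.
  by rewrite s1.
have split_mrg (p : degfun * degfun) :
    degrees (pairs A) (fun e => mrg p e) -> (res W1 (mrg p), res W2 (mrg p)) = p ->
    [/\ supported W1 (fun e => p.1 e), supported W2 (fun e => p.2 e),
        degrees (pairs A) (fun e => p.1 e) & degrees (pairs A) (fun e => p.2 e)].
  move=> dm pE.
  have p1E e : p.1 e = if e \in sideE W1 then mrg p e else ord0.
    by rewrite -{1}pE ffunE.
  have p2E e : p.2 e = if e \in sideE W2 then mrg p e else ord0.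
    by rewrite -{1}pE ffunE.
  split; try by apply/supportedP => e eW; rewrite ?p1E ?p2E (negPf eW).
    by apply: degreesS dm => e; rewrite p1E; case: ifP; [left|right].
  by apply: degreesS dm => e; rewrite p2E; case: ifP; [left|right].
apply: eq_big => [p|p /andP[/andP[sm dm] /eqP pE]].
  apply/andP/andP => [[/andP[_ dm] /eqP pE]|].
    by have [-> -> -> ->] := split_mrg p dm pE.
  case=> /andP[s1 d1] /andP[s2 d2]; have mE := mrgE p s1 s2.
  have := s1 => /supportedP s1'; have := s2 => /supportedP s2'.
  split; last first.
    rewrite -pair_eqE /=; apply/andP; split; apply/eqP/ffunP => e; rewrite !ffunE.
      by have [//|e1] := boolP (e \in sideE W1); apply: val_inj; rewrite /= s1'.
    have [e2|e2] := boolP (e \in sideE W2); last by apply: val_inj; rewrite /= s2'.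
    by case: ifPn => // /disE; rewrite e2.
  apply/andP; split; last exact: degrees_add sat1 sat2 dis s1 s2 mE d1 d2.
  apply/supportedP => e; rewrite inE in_setU negb_or => /andP[e1 e2].
  by rewrite mE s1' ?s2' ?inE.
have [s1 s2 d1 d2] := split_mrg p dm pE.
rewrite cardsU disjoint_setI0 // cards0 subn0; apply: weightD.
- exact: mrgE.
- move=> e; have [e1|e1] := boolP (e \in sideE W1); last first.
    by left; apply: (supportedP _ _ s1).
  by right; apply: (supportedP _ _ s2); rewrite disE.
- exact: degrees_bound sat1 s1 d1.
- exact: degrees_bound sat2 s2 d2.
Qed.

Lemma components_partition A : partition (components A) setT.
Proof.
apply: equivalence_partitionP => u v w _ _ _; split; first exact: connect0.
by move=> uv; apply: (same_connect (@connect_adjacent_sym _ A) uv).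
Qed.

Lemma componentsP A C : C \in components A ->
  exists2 u, u \in C & C = [set v | connect (adjacent A) u v].
Proof.
case/imsetP => u _ ->; exists u; first by rewrite !inE connect0.
by apply/setP => v; rewrite !inE.
Qed.

Lemma component_saturated A C : C \in components A -> saturated A C.
Proof. by case/componentsP => u _ ->; apply: connect_saturated. Qed.

Lemma degree_series_components A :
  degree_series A setT = \prod_(C in components A) degree_series A C.
Proof.
have /and3P[/eqP <- tI _] := components_partition A.
have : components A \subset components A by [].
(* Generalised to subfamilies [P] of the components, so that they can be split off one at a time. *)
move: {1 3 4}(components A) => P sP.
elim: {P}_.+1 {-2}P (ltnSn #|P|) sP => // k IH P le_k sP.
have [->|/set0Pn[C CP]] := eqVneq P set0.
  by rewrite big_set0 /cover big_set0 degree_series0.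
rewrite (big_setD1 C) //= -IH; first last.
- by apply: subset_trans sP; apply: subD1set.
- by move: le_k; rewrite (cardsD1 C) CP.
have -> : cover P = C :|: cover (P :\ C) by rewrite /cover (big_setD1 C).
have satP D : D \in P -> saturated A D by move/(subsetP sP)/component_saturated.
have satU : saturated A (cover (P :\ C)).
  apply/saturatedP => x xA; apply/bigcupP/bigcupP => -[D DP xD]; exists D => //;
    have /satP/saturatedP satD : D \in P by move: DP; rewrite inE => /andP[].
    by rewrite -satD.
  by rewrite satD.
rewrite degree_seriesU ?(satP C) //.
apply: bigcup_disjoint => D; rewrite in_setD1 => /andP[DC DP].
by apply: (trivIsetP tI); rewrite ?(subsetP sP) // eq_sym.
Qed.

End DegreeSeries.

(** * From degree series to interior polynomials *)

Section InteriorPoly.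
Variables (G : bigraph) (leE : rel (classE G)).
Hypotheses (leE_total : total leE) (leE_anti : antisymmetric leE).
Hypothesis leE_trans : transitive leE.
Implicit Types (A : {set edge G}) (W C : {set vertex G}).

Lemma spans_edges_in A C : spans (edges_in A C) C.
Proof. by apply/spansP => x; rewrite inE => /and3P[_ -> ->]. Qed.

Lemma connects_edges_in A C : C \in components A -> connects (edges_in A C) C.
Proof.
move=> CA; have /saturatedP satC := component_saturated CA.
have [u0 _ defC] := componentsP CA; apply/connectsP => u v uC vC.
have uv : connect (adjacent A) u v.
  move: uC vC; rewrite defC !inE => u0u; apply: connect_trans.
  by rewrite connect_adjacent_sym.
pose Z := [set w in C | connect (adjacent (edges_in A C)) u w].
have satZ : saturated A Z.
  apply/saturatedP => x xA; rewrite !inE satC //; case xC: (inr _ \in C) => //=.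
  apply: (same_connect_r (@connect_adjacent_sym _ _)); apply: connect1.
  by apply: adjacent_ends; rewrite inE xA satC // xC.
have := saturated_connect satZ uv; rewrite !inE uC vC connect0 /=.
by move=> <-.
Qed.

Lemma degrees_edges_in A C h : saturated A C -> supported C h ->
  degrees (pairs (edges_in A C)) h = degrees (pairs A) h.
Proof.
move=> /saturatedP sat /supportedP sh; apply: eq_forallb => X.
rewrite -[in LHS](andbC (X \subset _)) -[in RHS](andbC (X \subset _)).
case sX: (X \subset _) => //; congr (_ ==> (_ < #|pred_of_set _|)%N).
apply/setP => v; apply/nbr_pairsP/nbr_pairsP => -[x [xA xX ->]]; exists x; split=> //.
  by move: xA; rewrite inE => /andP[].
have xC : endE x \in sideE C.
  by apply: contraLR (subsetP sX _ xX) => /sh; rewrite inE => ->.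
by move: xC; rewrite !inE xA sat //= andbb.
Qed.

(** A single vertex carries only h = 0, of weight 1 - x. Otherwise hypertrees are bases, |C| equals
    |N(Q)| + |Q|, and [sum_degrees] applies. *)
Lemma degree_series_component A C : C \in components A ->
  degree_series A C = (1 - 'X) * interior_poly leE C (edges_in A C).
Proof.
move=> CA; have satC := component_saturated CA.
have BC := spans_edges_in A C; have cC := connects_edges_in CA.
rewrite /interior_poly; have [C1|C1] := eqVneq #|C| 1%N.
  rewrite /degree_series C1 mulr1 (big_pred1 [ffun=> ord0]).
    rewrite /weight big1 => [|e _]; last by rewrite ffunE.
    rewrite (_ : [set _ | _] = set0) ?cards0 ?mul1r ?expr1 //.
    by apply/setP => e; rewrite !inE ffunE.
  have B0 : edges_in A C = set0.
    apply/setP => x; rewrite [RHS]inE; apply/negP => /(spansP _ _ BC)[xV xE].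
    by have /eqP/cards1P[u Cu] := C1; move: xV xE; rewrite Cu !inE => /eqP <-.
  move=> h; apply/andP/eqP => [[sh]|->].
    rewrite -(degrees_edges_in satC sh) B0 => /draconianP D.
    apply/ffunP => e; rewrite ffunE; apply: val_inj => /=.
    apply/eqP; apply: contraT; rewrite -lt0n => he.
    have N0 : nbr (pairs (set0 : {set edge G})) [set e] = set0.
      apply/setP => v; rewrite [RHS]inE.
      by apply/nbr_pairsP => -[x [xA _ _]]; rewrite inE in xA.
    have := D [set e]; rewrite N0 cards0 ltn0.
    apply; last by rewrite sub1set inE.
    by apply/set0Pn; exists e; rewrite inE.
  split; first by apply/supportedP => e _; rewrite ffunE.
  apply/draconianP => X /set0Pn[e eX] /subsetP/(_ e eX).
  by rewrite inE ffunE.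
have C2 : (1 < #|C|)%N.
  rewrite ltn_neqAle eq_sym C1 card_gt0.
  by have [u uC _] := componentsP CA; apply/set0Pn; exists u.
have cardC : #|C| = (#|nbr (pairs (edges_in A C)) (sideE C)| + #|sideE C|)%N.
  by rewrite (nbr_sides BC cC C2) card_sides.
have nbr_le e : e \in sideE C -> (#|nbr (pairs (edges_in A C)) [set e]| <= #|edge G|)%N.
  move=> _; apply: leq_trans (leq_imset_card _ _) _.
  apply: leq_trans (_ : #|pairs (edges_in A C)| <= _)%N.
    by apply: subset_leq_card; apply/subsetP => p; rewrite inE => /andP[].
  by apply: leq_trans (leq_imset_card _ _) _; apply: max_card.
rewrite (eq_bigl (fun f : {ffun classE G -> 'I_#|edge G|.+1} =>
    base (pairs (edges_in A C)) (sideE C) (fun e => f e))); last first.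
  by move=> f; rewrite /= (hypertreeE BC cC C2).
rewrite (eq_bigr (fun f : {ffun classE G -> 'I_#|edge G|.+1} =>
    'X^#|[set e | inactive (pairs (edges_in A C)) (sideE C) leE (fun e => f e) e]|)); last first.
  move=> f _; congr ('X^_); apply: eq_card => e.
  rewrite !inE /internally_inactive /inactive [e \in sideE C]inE; congr (_ && _).
  by apply: eq_existsb => e'; rewrite [_ \in sideE C]inE (hypertreeE BC cC C2).
rewrite -(sum_degrees (nbr_connected BC cC) (sideE_neq0 BC cC C2) leE_total leE_anti
           leE_trans (nbr_neq0 cC C2) nbr_le) -cardC.
by apply: eq_bigl => h; apply: andb_id2l => sh; rewrite (degrees_edges_in satC sh).
Qed.

(** Each component contributes a factor 1 - x. The vertex [v] shows that there is a component, so
    exactly one factor is left beyond those in [interior_poly']. *)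
Lemma degree_seriesT A (v : vertex G) :
  degree_series A setT = (1 - 'X) * interior_poly' leE A.
Proof.
rewrite degree_series_components (eq_bigr _ (@degree_series_component A)).
rewrite big_split /= prodr_const /interior_poly' mulrA -exprS prednK //.
have /and3P[/eqP cov _ _] := components_partition A.
have : v \in cover (components A) by rewrite cov.
by case/bigcupP => C CA _; apply/card_gt0P; exists C.
Qed.

(** For fixed [h] the weight does not depend on S, so after exchanging the sums the relation for
    truth values applies to each [h]. *)
Lemma alt_sum_degree_series (n : nat) (eps del : 'I_n -> edge G) :
  is_cycle (flatten [seq [:: eps i; del i] | i <- enum 'I_n]) ->
  \sum_(S : {set edge G} | S \subset [set eps i | i : 'I_n])
    (-1) ^+ #|S| * degree_series (~: S) setT = 0.
Proof.
move=> cyc; have alt0 := cycle_alt_sum cyc.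
transitivity (\sum_(h : {ffun classE G -> 'I_#|edge G|.+1})
  \sum_(S : {set edge G} | S \subset [set eps i | i : 'I_n])
     ((-1) ^+ #|S| * (degrees (pairs (~: S)) (fun e => h e))%:R)%:P
     * weight #|[set: vertex G]| (fun e => h e)).
  rewrite exchange_big; apply: eq_bigr => S _ /=.
  rewrite /degree_series mulr_sumr big_mkcond; apply: eq_bigr => h _.
  have -> : supported setT (fun e => h e : nat).
    by apply/supportedP => e; rewrite !inE.
  rewrite rmorphM rmorphXn rmorphN1 rmorph_nat /=.
  by case: ifP => _; rewrite ?mulr1 ?mulr0 ?mul0r.
apply: big1 => h _; rewrite -mulr_suml -rmorph_sum /=.
by rewrite alt0 mul0r.
Qed.

End InteriorPoly.

Theorem corollary1p3 (G : bigraph) (leE : rel (classE G))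
  (leE_total : total leE) (leE_anti : antisymmetric leE)
  (leE_trans : transitive leE)
  (n : nat) (eps del : 'I_n -> edge G)
  (cycle_eps_del : is_cycle (flatten [seq [:: eps i; del i] | i <- enum 'I_n])) :
  interior_poly' leE [set: edge G] =
  \sum_(S : {set edge G} | (S != set0) && (S \subset [set eps i | i : 'I_n]))
    (-1) ^+ (#|S| - 1) * interior_poly' leE (~: S).
Proof.
pose v : vertex G := inl (endV (eps (Ordinal (cycle_pos cycle_eps_del)))).
(* Degree series differ from the polynomials I' by this factor, which can be cancelled over the
   integers. *)
have X1 : 1 - 'X != 0 :> {poly int} by rewrite -opprB oppr_eq0 polyXsubC_eq0.
apply: (mulfI X1); rewrite -degree_seriesT //.
have := alt_sum_degree_series cycle_eps_del.
(* The empty set gives the term of [G] itself; moving the other terms across turns the exponent |S|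
   into |S| - 1. *)
rewrite (bigD1 set0) ?sub0set //= cards0 mul1r setC0 => /eqP.
rewrite addr_eq0 => /eqP ->; rewrite mulr_sumr -sumrN.
apply: eq_big => [S|S /andP[_ S0]]; first by rewrite andbC.
rewrite (degree_seriesT leE_total leE_anti leE_trans _ v).
rewrite subn1 -{1}(prednK (_ : 0 < #|S|)%N) ?card_gt0 // exprS mulN1r mulNr opprK.
by rewrite mulrCA.
Qed.
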